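(* Let $\mathscr X=[0,1]$ and let $\eta=(\eta_x)_{x\in[0,1]}$ be the collection of Laplace functionals of the cluster processes $(S_x)_{x\in[0,1]}$ of a linear graphon Hawkes birth-death process with parameters $\lambda_\infty,h,W,B$ and lifetimes $(J_x)_{x\in[0,1]}$, as described in the context. Then $\eta$ is a fixed point of the operator $\Phi$ defined in the context: $\eta=\Phi(\eta)$, i.e. for each $x\in[0,1]$, $\eta_x=\Phi_x(\eta)$.
   Context: Parameters: $\lambda_\infty:[0,1]\to\mathbb R_+$ in $L^1[0,1]$; $h:\mathbb R_+\to\mathbb R_+$ in $L^1(\mathbb R_+)$; $W:[0,1]^2\to\mathbb R_+$ measurable; $B=(B_{xy})$ a nonnegative stochastic process on $[0,1]^2$, separable with respect to the open subsets of $[0,1]^2$; there are conjugate exponents $p,q\in[1,\infty]$ with $W(\cdot,y)\in L^p[0,1]$ and $\mathbb E[B_{\cdot y}]\in L^q[0,1]$ for a.e. $y$. $J=(J_x)_{x\in[0,1]}$ is an $\mathbb R_+$-valued stochastic process on $[0,1]$, separable with respect to the open subsets of $[0,1]$; put $\mathscr J_x(u)=\mathbb P(J_x>u)$, $\bar{\mathscr J}_x(u)=1-\mathscr J_x(u)$. Cluster $S_x$: start with one event at location $x$ at time $0$; every event at time $s$ and location $y$ carries an independent realization $B(s)$ of $B$ and generates offspring according to a Poisson process on $[s,\infty)\times[0,1]$ with intensity $B_{zy}(s)W(z,y)h(t-s)\,\mathrm dt\,\mathrm dz$; each event at location $y$ has a lifetime distributed as $J_y$, independent of everything else (death does not affect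 offspring). $S_x(u)$ is the collection of events (ancestor included) born by time $u$ whose lifetime has not expired at time $u$. Laplace functionals: $\mathrm{BM}_+[0,1]$ is the set of bounded measurable functions $f:[0,1]\to\mathbb R_+$. For a point or birth-death process $Z$ with locations in $[0,1]$, $\mathcal L_Z(f,t)=\mathbb E[\exp(-\sum_{x_i\in Z(t)}f(x_i))]$, where $Z(t)$ registers the locations of events that have occurred and not expired by time $t$. For a family $Z=(Z_x)_{x\in[0,1]}$ of such processes, $\mathcal L_Z(f,t)=(\mathcal L_{Z_x}(f,t))_{x\in[0,1]}$; $\mathbb L^{[0,1]}$ is the set of all such transforms $\mathcal L_Z$. $\eta_x=\mathcal L_{S_x}$. Operator: let $\beta_x$ be the Laplace functional of $B_{\cdot x}$, $\beta_x(g)=\mathbb E[\exp(-\int_0^1g(y)B_{yx}\,\mathrm dy)]$, and $\gamma_x(f,u)=\bar{\mathscr J}_x(u)+\mathscr J_x(u)e^{-f(x)}$. For $\xi\in\mathbb L^{[0,1]}$, $f\in\mathrm{BM}_+[0,1]$, $u\ge0$, $$\Phi_x(\xi)(f,u):=\gamma_x(f,u)\,\beta_x\Big(y\mapsto\int_0^u\big(1-\xi_y(f,u-s)\big)W(y,x)h(s)\,\mathrm ds\Big),\qquad\Phi(\xi)=(\Phi_x(\xi))_{x\in[0,1]}.$$ *)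

(* Defs.v *)
From HB Require Import structures.
From mathcomp Require Export all_boot all_order all_algebra.
From mathcomp Require Export all_classical all_reals all_analysis.
From mathcomp Require Export measurable_realfun.
Export Order.TTheory GRing.Theory Num.Theory.
Export numFieldNormedType.Exports.

Set Implicit Arguments.
Unset Strict Implicit.
Unset Printing Implicit Defensive.

Local Open Scope classical_set_scope.
Local Open Scope ring_scope.
Local Open Scope ereal_scope.

Section laplace.
Context {R : realType}.

Definition unit_interval : set R := `[0%R, 1%R].

(* Functions on [0,1] are functions on [R] of which only the values on [0,1]
   matter; this predicate is membership of BM_+[0,1]. *)
Definition bounded_measurable_nonneg (f : R -> R) : Prop :=
  measurable_fun unit_interval f /\
  exists M : R, forall y, unit_interval y -> (0 <= f y <= M)%R.

(* [Z t w] is the set of (labels of) events that have occurred and not expired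
   by time [t] in the outcome [w]. The sum may be infinite, and
   exp (- oo) = 0. *)
Definition laplace d (Omega : measurableType d) (P : probability Omega R)
    (L : choiceType) (Z : R -> Omega -> set L) (location : L -> Omega -> R)
    (f : R -> R) (t : R) : \bar R :=
  \int[P]_w expeR (- \esum_(i in Z t w) (f (location i w))%:E).

End laplace.

Section processes.
Context {R : realType} {d : measure_display} {Omega : measurableType d}.

(* Doob separability of a process [X] with index set [D], with respect to the
   relatively open subsets of [D]. *)
Definition separable_process (P : probability Omega R) (T : topologicalType)
    (D : set T) (X : Omega -> T -> R) : Prop :=
  exists (C : set T) (N : set Omega),
    [/\ countable C, C `<=` D, P.-negligible N &
      forall (U : set T) (F : set R) (w : Omega), open U -> closed F -> ~ N w ->
        (forall t, (C `&` U) t -> F (X w t)) ->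
        forall t, (D `&` U) t -> F (X w t)].

End processes.

Section hawkes.
Context {R : realType}.
Local Notation I := (@unit_interval R).
Local Notation leb := (@lebesgue_measure R).

(* [OmegaB] and [OmegaJ] carry the processes [B] and [J]. *)
Context {dB : measure_display} {OmegaB : measurableType dB}.
Variable PB : probability OmegaB R.
Context {dJ : measure_display} {OmegaJ : measurableType dJ}.
Variable PJ : probability OmegaJ R.
Variables (lambda_oo h : R -> R) (W : R -> R -> R).
Variables (B : OmegaB -> R -> R -> R) (J : OmegaJ -> R -> R).

(* Membership of L^p[0,1], for p in [1, +oo]; measurability is part of
   [hawkes_parameters]. *)
Definition in_Lp (p : \bar R) (f : R -> \bar R) : Prop :=
  'N[leb]_p[f \_ I] < +oo.

(* Joint measurability of [B] and [J] in the outcome and the indices is what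
   makes the integrals of B over its indices, the value of B at the random
   location of an event, and the lifetime at a random location meaningful. *)
Record hawkes_parameters : Prop := {
  lambda_ge0 : forall y, I y -> (0 <= lambda_oo y)%R;
  lambda_L1 : leb.-integrable I (EFin \o lambda_oo);
  h_ge0 : forall t, (0 <= t)%R -> (0 <= h t)%R;
  h_L1 : leb.-integrable `[0%R, +oo[ (EFin \o h);
  W_ge0 : forall z y, I z -> I y -> (0 <= W z y)%R;
  W_measurable : measurable_fun (I `*` I) (fun p : R * R => W p.1 p.2);
  B_ge0 : forall w z y, I z -> I y -> (0 <= B w z y)%R;
  B_measurable : measurable_fun (setT `*` (I `*` I))
    (fun q : OmegaB * (R * R) => B q.1 q.2.1 q.2.2);
  B_separable : separable_process PB (I `*` I)
    (fun w (p : R * R) => B w p.1 p.2);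
  W_B_conjugate : exists p q : \bar R,
    [/\ 1 <= p, 1 <= q, p^-1 + q^-1 = 1 &
      {ae leb, forall y, I y ->
        in_Lp p (fun z => (W z y)%:E) /\
        in_Lp q (fun z => \int[PB]_w (B w z y)%:E)}];
  J_ge0 : forall w y, I y -> (0 <= J w y)%R;
  J_measurable : measurable_fun (setT `*` I)
    (fun q : OmegaJ * R => J q.1 q.2);
  J_separable : separable_process PJ I J
}.

Section cluster.
Context {d : measure_display} {Omega : measurableType d}.

(* Events carry Ulam-Harris labels: [[::]] is the ancestor, and the children of
   the event [v] are among the [rcons v i], i in nat; the other labels are
   unused, as told by [born]. [pos v w] is the pair (time, location). The
   realization of B carried by [v] is the path [B (mark v w)], i.e. [mark v] is
   a random outcome in [OmegaB]. *)
Record event_tree := EventTree {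
  born : seq nat -> Omega -> bool;
  pos : seq nat -> Omega -> R * R;
  mark : seq nat -> Omega -> OmegaB;
  life : seq nat -> Omega -> R
}.

Variables (P : probability Omega R) (S : event_tree).

Definition birth (v : seq nat) (w : Omega) : R := (pos S v w).1.
Definition location (v : seq nat) (w : Omega) : R := (pos S v w).2.

(* The sigma-algebra generated by the births of the labels in [V] and by the
   marks of the labels in [U]. *)
Definition history (V U : set (seq nat)) : set (set Omega) :=
  <<s [set E | [\/ exists2 v, V v & E = [set w | born S v w],
                   exists v (A : set (R * R)),
                     [/\ V v, measurable A & E = pos S v @^-1` A] |
                   exists v (A : set OmegaB),
                     [/\ U v, measurable A & E = mark S v @^-1` A]]] >>.

(* Point process of the offspring of [v]. *)
Definition offspring (v : seq nat) (w : Omega) (A : set (R * R)) : \bar R :=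
  counting [set i | born S (rcons v i) w /\ A (pos S (rcons v i) w)].

(* Intensity measure B_{zy}(s) W(z,y) h(t-s) dt dz on [s, +oo[ x [0,1] of the
   offspring of an event [v] born at (s,y). *)
Definition intensity (v : seq nat) (w : Omega) (A : set (R * R)) : \bar R :=
  if born S v w then
    \int[leb \x leb]_(p in A `&` (`[birth v w, +oo[ `*` I))
      (B (mark S v w) p.2 (location v w) * W p.2 (location v w)
        * h (p.1 - birth v w))%:E
  else 0.

(* Probability of the value [k] under the Poisson law of mean [m] in
   [0, +oo]; for m = +oo the law is the Dirac mass at +oo. *)
Definition poisson_mass (m : \bar R) (k : nat) : \bar R :=
  if m is r%:E then poisson_prob r k [set k] else 0.

Record is_cluster (x : R) : Prop := {
  born_measurable : forall v, measurable_fun setT (born S v);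
  pos_measurable : forall v, measurable_fun setT (pos S v);
  mark_measurable : forall v, measurable_fun setT (mark S v);
  life_measurable : forall v, measurable_fun setT (life S v);
  (* For an unused label the position is arbitrary. *)
  location_in : forall v w, I (location v w);
  ancestor : forall w, born S [::] w /\ pos S [::] w = (0%R, x);
  child_parent : forall v i w, born S (rcons v i) w ->
    born S v w /\ (birth v w <= birth (rcons v i) w)%R;
  (* Given the births up to generation n and the marks of the previous
     generations, the marks of generation n are i.i.d. with law PB. *)
  marks_independent : forall (n : nat) (s : seq (seq nat))
      (A : seq nat -> set OmegaB) (G : set Omega),
    uniq s -> (forall v, v \in s -> size v = n) ->
    (forall v, measurable (A v)) ->
    history [set v | (size v <= n)%N] [set v | (size v < n)%N] G ->
    P (G `&` \bigcap_(v in [set` s]) (mark S v @^-1` A v))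
      = P G * \prod_(v <- s) PB (A v);
  (* Given the births and the marks up to generation n, the offspring of the
     events of generation n are independent Poisson processes: the counts on
     finitely many disjoint (event, set) pairs are independent Poisson. *)
  offspring_poisson : forall (n k : nat) (v : 'I_k -> seq nat)
      (A : 'I_k -> set (R * R)) (c : 'I_k -> nat) (G : set Omega),
    (forall j, size (v j) = n) -> (forall j, measurable (A j)) ->
    (forall i j, i != j -> v i = v j -> A i `&` A j = set0) ->
    history [set v | (size v <= n)%N] [set v | (size v <= n)%N] G ->
    P (G `&` [set w | forall j, offspring (v j) w (A j) = (c j)%:R%:E])
      = \int[P]_(w in G) \prod_(j < k)
          poisson_mass (intensity (v j) w (A j)) (c j);
  (* Given all births and marks, the lifetimes are independent, and that of an
     event at location y has the law of J_y. *)
  lifetimes_independent : forall (s : seq (seq nat)) (A : seq nat -> set R)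
      (G : set Omega),
    uniq s -> (forall v, measurable (A v)) -> history setT setT G ->
    P (G `&` \bigcap_(v in [set` s]) (life S v @^-1` A v))
      = \int[P]_(w in G) \prod_(v <- s)
          PJ [set w' | A v (J w' (location v w))]
}.

Definition alive (u : R) (w : Omega) : set (seq nat) :=
  [set v | [/\ born S v w, (birth v w <= u)%R
             & (u < birth v w + life S v w)%R]].

End cluster.

Definition cluster_laplace d (Omega : measurableType d)
    (P : probability Omega R) (S : R -> @event_tree d Omega)
    (x : R) (f : R -> R) (u : R) : \bar R :=
  laplace P (alive (S x)) (location (S x)) f u.

Definition survival (x u : R) : \bar R := PJ [set w | (u < J w x)%R].

Definition gamma (x : R) (f : R -> R) (u : R) : \bar R :=
  (1 - survival x u) + survival x u * (expR (- f x))%:E.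

Definition beta (x : R) (g : R -> \bar R) : \bar R :=
  \int[PB]_w expeR (- \int[leb]_(y in I) (g y * (B w y x)%:E)).

(* The formula makes sense for any [0,1]-valued family [xi], in particular for
   a family of Laplace functionals. *)
Definition Phi (xi : R -> (R -> R) -> R -> \bar R)
    (x : R) (f : R -> R) (u : R) : \bar R :=
  gamma x f u *
  beta x (fun y => \int[leb]_(s in `[0%R, u])
    ((1 - xi y f (u - s)%R) * (W y x * h s)%:E)).

End hawkes.

Arguments event_tree {R dB} OmegaB {d} Omega.

(* Main.v *)
(* Everything is written as E[exp(-cost)] with costs in [0, +oo]. Condition on
   the births and marks of all events, then average over the lifetimes: an
   event at location y born t before the horizon u carries the cost
   -ln gamma_y(f, t). Now peel off generations from the last one. If the events
   of generation n+1 carry a cost c(y, t), averaging over the Poisson offspring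
   of generation n (given births and marks up to generation n), then over the
   marks of generation n, replaces c by a cost carried by generation n, namely
   -ln of the operator Phi applied to exp(-c). Hence the Laplace functional of
   the tree cut after generation n is the n-th iterate of Phi started at gamma.
   These iterates decrease to eta, and by monotone and dominated convergence
   Phi passes to the limit. No branching property of subtrees is needed, and
   the measurability of (y, t) |-> eta_y(f, t) comes from this limit. *)

(* The law of the cluster is given by finite-dimensional data only: product sets for marks and
   lifetimes, joint counts on disjoint sets for offspring. Conditional statements are therefore
   phrased as [cond_eq], equality of integrals over every event of a sigma-algebra. They are carried
   from indicators and counts to exponentials of costs one factor at a time, then from finite to
   infinite families of events by dominated convergence, all integrands lying in [0, 1]. Costs are
   propagated rather than their exponentials because they add up over events: an infinite family
   gives an [esum], with no infinite product to define. The integrability of the parameters holds at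
   almost every location only, so an intensity may be infinite and the cost +oo has to be allowed. A
   cost depends on the location and on the time left before the horizon. The same function then
   serves every event and every starting point, which enters only through the position of the
   ancestor. So the limit gives eta_y(f, t) for all y and t at once, as the integral inside Phi
   requires. *)
Require Import Defs.
From mathcomp Require Import ring.

Set Implicit Arguments.
Unset Strict Implicit.
Unset Printing Implicit Defensive.

Local Open Scope classical_set_scope.
Local Open Scope ring_scope.

Import HBNNSimple.

Local Open Scope ereal_scope.

(** * Exponentials of costs in [0, +oo] *)

Section nexp.
Context {R : realType}.
Implicit Types (x y : \bar R).

Definition nexp x : \bar R := expeR (- x).

Lemma nexp_ge0 x : 0 <= nexp x.
Proof. exact: expeR_ge0. Qed.

Lemma nexp0 : nexp 0 = 1.
Proof. by rewrite /nexp oppe0 expeR0. Qed.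

Lemma nexpy : nexp +oo = 0.
Proof. by []. Qed.

Lemma le_nexp x y : (nexp y <= nexp x) = (x <= y).
Proof. by rewrite /nexp lee_expeR leeN2. Qed.

Lemma nexp_le1 x : 0 <= x -> nexp x <= 1.
Proof. by move=> x0; rewrite -nexp0 le_nexp. Qed.

Lemma nexpD x y : 0 <= x -> 0 <= y -> nexp (x + y) = nexp x * nexp y.
Proof.
move=> x0 y0; rewrite /nexp -expeRD; congr expeR.
by case: x y x0 y0 => [r| |] [s| |] //= _ _; rewrite opprD.
Qed.

Lemma nexp_sum (T : eqType) (s : seq T) (a : T -> \bar R) :
  (forall t, t \in s -> 0 <= a t) ->
  nexp (\sum_(t <- s) a t) = \prod_(t <- s) nexp (a t).
Proof.
elim: s => [|t s ih] a0; first by rewrite !big_nil nexp0.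
have a0s t' : t' \in s -> 0 <= a t' by move=> ts; rewrite a0// inE ts orbT.
rewrite !big_cons nexpD ?ih// ?a0 ?inE ?eqxx//.
by rewrite big_seq; apply: sume_ge0 => t' ts; rewrite a0s.
Qed.

Lemma nexp_lne x : 0 <= x -> nexp (- lne x) = x.
Proof. by move=> x0; rewrite /nexp oppeK; apply/eqP; rewrite lneK_eq. Qed.

Lemma nlne_ge0 x : x <= 1 -> 0 <= - lne x.
Proof. by move=> x1; rewrite oppe_ge0 lne_le0. Qed.

(** Continuity of exp(-x) on [0, +oo] includes the point +oo, because total costs and rates may
    increase to infinity. *)
Lemma nexp_cvg (u : (\bar R)^nat) x : (forall n, 0 <= u n) -> 0 <= x ->
  u @ \oo --> x -> nexp (u n) @[n --> \oo] --> nexp x.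
Proof.
move=> u0; case: x => [r _|_|//].
- move=> /fine_cvgP[ufin ur].
  have : (expR (- fine (u n)))%:E @[n --> \oo] --> (expR (- r))%:E.
    apply: cvg_EFin; first by near=> n.
    have cexp : {for r, continuous (fun z : R => expR (- z)%R)}.
      by apply: continuous_comp; [exact: opp_continuous|exact: continuous_expR].
    exact: (cvg_comp _ _ ur cexp).
  apply: cvg_trans; apply: near_eq_cvg; near=> n.
  have /fineK un : u n \is a fin_num by near: n.
  by rewrite -un.
- move=> uy; rewrite nexpy; apply/fine_cvgP; split.
    near=> n; rewrite ge0_fin_numE ?nexp_ge0//.
    by rewrite (le_lt_trans (nexp_le1 (u0 n)))// ltry.
  apply/cvgrPdist_le => e e0; near=> n.
  rewrite sub0r normrN ger0_norm ?fine_ge0 ?nexp_ge0//=.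
  (* Beyond the level [- ln e], exp(-x) is at most [e]. *)
  have h : (- ln e)%:E <= u n by near: n; move: uy => /cvgeyPge; exact.
  rewrite -lee_fin fineK; last first.
    rewrite ge0_fin_numE ?nexp_ge0//.
    by rewrite (le_lt_trans (nexp_le1 (u0 n)))// ltry.
  by move: h; rewrite -le_nexp {2}/nexp /= opprK lnK.
Unshelve. all: by end_near. Qed.

Lemma measurable_lne : measurable_fun [set: \bar R] (@lne R).
Proof.
rewrite (_ : @lne R = fun x : \bar R => if 0 < x then er_map (@ln R) x else -oo).
  apply: measurable_fun_ifT => //.
    apply: (measurable_fun_bool true); rewrite setTI.
    have := @emeasurable_itv R `]0, +oo[%R; congr (measurable _).
    by apply: funext => x; rewrite propeqE /= in_itv/= ?andbT.
  apply: (@measurable_er_map _ (measurableTypeR R)); exact: measurable_ln.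
apply/funext => -[r| |]//=.
  by rewrite lte_fin ltNge; case: (leP r 0%R).
by rewrite ltry.
Qed.

Lemma measurable_expeR : measurable_fun [set: \bar R] (@expeR R).
Proof.
rewrite (_ : @expeR R = fun x : \bar R => if -oo < x then er_map (@expR R) x else 0).
  apply: measurable_fun_ifT => //.
    apply: (measurable_fun_bool true); rewrite setTI.
    have := @emeasurable_itv R (Interval (BRight -oo%E) +oo%O); congr (measurable _).
    by apply: funext => x; rewrite propeqE /= in_itv/= ?andbT.
  apply: (@measurable_er_map _ (measurableTypeR R)); exact: measurable_expR.
by apply/funext => -[r| |]//=; rewrite ltNyr.
Qed.

Lemma measurable_nexp d (T : measurableType d) (D : set T) (f : T -> \bar R) :
  measurable_fun D f -> measurable_fun D (fun t => nexp (f t)).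
Proof.
move=> mf; apply: (measurableT_comp measurable_expeR).
exact: measurableT_comp.
Qed.

Lemma measurable_nlne d (T : measurableType d) (D : set T) (f : T -> \bar R) :
  measurable_fun D f -> measurable_fun D (fun t => - lne (f t)).
Proof.
move=> mf; apply: measurableT_comp => //.
exact: (measurableT_comp measurable_lne).
Qed.

End nexp.

(** * Measurable functions with values in [0, 1] *)

Section unit_functions.
Context {R : realType} d (T : measurableType d).

(** The bound 1 keeps every value finite, so that products pass to limits, and it dominates all
    integrands by [cst 1]. *)
Definition unit_fun (a : T -> \bar R) : Prop :=
  measurable_fun setT a /\ forall t, 0 <= a t <= 1.

Lemma unit_fun_ge0 a t : unit_fun a -> 0 <= a t.
Proof. by case=> _ /(_ t)/andP[]. Qed.

Lemma unit_fun_le1 a t : unit_fun a -> a t <= 1.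
Proof. by case=> _ /(_ t)/andP[]. Qed.

Lemma unit_fun_fin a t : unit_fun a -> a t \is a fin_num.
Proof.
move=> ua; rewrite ge0_fin_numE ?unit_fun_ge0//.
by rewrite (le_lt_trans (unit_fun_le1 _ ua))// ltry.
Qed.

Lemma unit_funM a b : unit_fun a -> unit_fun b -> unit_fun (fun t => a t * b t).
Proof.
move=> ua ub; split; first by apply: emeasurable_funM; [case: ua|case: ub].
move=> t; rewrite mule_ge0 ?unit_fun_ge0//= -[leRHS]mule1.
by apply: lee_pmul; rewrite ?unit_fun_ge0 ?unit_fun_le1.
Qed.

Lemma unit_fun_cst1 : unit_fun (cst 1).
Proof. by split => // t; rewrite lee01 lexx. Qed.

Lemma unit_fun_prod (I : eqType) (s : seq I) (a : I -> T -> \bar R) :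
  (forall i, i \in s -> unit_fun (a i)) ->
  unit_fun (fun t => \prod_(i <- s) a i t).
Proof.
elim: s => [|i s ih] ua.
  by under eq_fun do rewrite big_nil; exact: unit_fun_cst1.
under eq_fun do rewrite big_cons.
apply: unit_funM; first by apply: ua; rewrite inE eqxx.
by apply: ih => j js; apply: ua; rewrite inE js orbT.
Qed.

Lemma unit_fun_indic (A : set T) : measurable A -> unit_fun (fun t => (\1_A t)%:E).
Proof.
move=> mA; split; first by apply/measurable_EFinP; exact: measurable_indic.
by move=> t; rewrite !lee_fin indicE; case: (_ \in _); rewrite ?lexx ?ler01.
Qed.

Lemma unit_fun_nexp (c : T -> \bar R) :
  measurable_fun setT c -> (forall t, 0 <= c t) -> unit_fun (fun t => nexp (c t)).
Proof.
move=> mc c0; split; first exact: measurable_nexp.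
by move=> t; rewrite nexp_ge0 nexp_le1.
Qed.

Lemma unit_fun_integral01 (P : probability T R) a :
  unit_fun a -> 0 <= \int[P]_t a t <= 1.
Proof.
move=> ua; apply/andP; split.
  by apply: integral_ge0 => t _; exact: unit_fun_ge0.
apply: (@le_trans _ _ (\int[P]_t cst 1 t)).
  apply: ge0_le_integral => //.
  - by move=> t _; exact: unit_fun_ge0.
  - by case: ua.
  - by move=> t _; exact: unit_fun_le1.
by rewrite integral_cst//= mul1e; exact: probability_le1.
Qed.

Lemma unit_fun_integral_fin (P : probability T R) a :
  unit_fun a -> \int[P]_t a t \is a fin_num.
Proof.
move=> /(unit_fun_integral01 P)/andP[a0 a1].
by rewrite ge0_fin_numE// (le_lt_trans a1)// ltry.
Qed.

End unit_functions.

Lemma unit_fun_comp {R : realType} d (T : measurableType d) d' (T' : measurableType d')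
    (a : T -> \bar R) (th : T' -> T) :
  unit_fun a -> measurable_fun setT th -> unit_fun (fun t => a (th t)).
Proof. by move=> [ma a01] mth; split => //; exact: measurableT_comp. Qed.

(** * Weighted image measures that agree on a pi-system *)

Section equal_weighted_images.
Context {R : realType} d1 d2 d (Z1 : measurableType d1) (Z2 : measurableType d2)
  (T : measurableType d).
Variables (P1 : probability Z1 R) (P2 : probability Z2 R).
Variables (th1 : Z1 -> T) (th2 : Z2 -> T) (H1 : Z1 -> \bar R) (H2 : Z2 -> \bar R).
Hypotheses (mth1 : measurable_fun setT th1) (mth2 : measurable_fun setT th2).
Hypotheses (uH1 : unit_fun H1) (uH2 : unit_fun H2).
Variable G : set (set T).
Hypotheses (mG : @measurable _ T = <<s G >>) (GI : setI_closed G) (GT : G setT).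
Hypothesis P12 : forall C, G C ->
  \int[P1]_z ((\1_C (th1 z))%:E * H1 z) = \int[P2]_z ((\1_C (th2 z))%:E * H2 z).

Let uI d0 (Z : measurableType d0) (th : Z -> T) (H : Z -> \bar R) C :
  measurable_fun setT th -> unit_fun H -> measurable C ->
  unit_fun (fun z => (\1_C (th z))%:E * H z).
Proof.
move=> mth uH mC; apply: unit_funM => //.
exact: (unit_fun_comp (unit_fun_indic mC)).
Qed.

(** Pi-lambda theorem for two finite measures. Finiteness allows the subtraction for complements,
    and [GT] provides equal total masses. *)
Let indic_eq : forall C, measurable C ->
  \int[P1]_z ((\1_C (th1 z))%:E * H1 z) = \int[P2]_z ((\1_C (th2 z))%:E * H2 z).
Proof.
have compl d0 (Z : measurableType d0) (P : probability Z R) (th : Z -> T)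
    (H : Z -> \bar R) C : measurable_fun setT th -> unit_fun H -> measurable C ->
    \int[P]_z ((\1_(~` C) (th z))%:E * H z) =
    \int[P]_z ((\1_setT (th z))%:E * H z) - \int[P]_z ((\1_C (th z))%:E * H z).
  move=> mth uH mC.
  have u1 := uI mth uH mC; have u2 := uI mth uH (measurableC mC).
  have u3 := uI mth uH measurableT.
  apply/eqP; rewrite eq_sym sube_eq ?unit_fun_integral_fin//; last first.
    by rewrite fin_num_adde_defr// unit_fun_integral_fin.
  rewrite -ge0_integralD//; last 4 first.
  - by move=> z _; exact: unit_fun_ge0 u2.
  - by case: u2.
  - by move=> z _; exact: unit_fun_ge0 u1.
  - by case: u1.
  apply/eqP/eq_integral => z _.
  rewrite !indicE in_setC in_setT; case: (_ \in C) => /=.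
    by rewrite mul0e add0e.
  by rewrite mul0e adde0.
rewrite mG => C GC.
move: C GC; apply: (dynkin_induction mG) => //.
- exact: P12.
- move=> C mC PC; rewrite !compl//.
  by rewrite PC (P12 GT).
- move=> F mF tF PF.
  have bigc d0 (Z : measurableType d0) (P : probability Z R) (th : Z -> T)
    (H : Z -> \bar R) : measurable_fun setT th -> unit_fun H ->
    \int[P]_z ((\1_(\bigcup_k F k) (th z))%:E * H z) =
    \sum_(k <oo) \int[P]_z ((\1_(F k) (th z))%:E * H z).
    move=> mth uH; rewrite -integral_nneseries//; last 2 first.
    - by move=> n; case: (uI mth uH (mF n)).
    - by move=> n z _; exact: unit_fun_ge0 _ (uI mth uH (mF n)).
    apply: eq_integral => z _.
    rewrite -[H z]fineK ?unit_fun_fin// [LHS]muleC indic_bigcup// -nneseriesZl//.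
    by apply: eq_eseriesr => k _; rewrite muleC.
  rewrite (bigc _ _ P1 _ _ mth1 uH1) (bigc _ _ P2 _ _ mth2 uH2).
  by apply: eq_eseriesr => k _; exact: PF.
Qed.

Lemma eq_weighted_images (phi : T -> \bar R) :
  measurable_fun setT phi -> (forall t, 0 <= phi t) ->
  \int[P1]_z (phi (th1 z) * H1 z) = \int[P2]_z (phi (th2 z) * H2 z).
Proof.
move=> mphi phi0; pose g := nnsfun_approx measurableT mphi.
have mg n r : measurable (g n @^-1` [set r]) by [].
(* Along simple functions, the integral depends on [P], [th] and [H] only through weighted integrals
   of indicators, by the same formula on both sides. *)
have approx d0 (Z : measurableType d0) (P : probability Z R) (th : Z -> T)
    (H : Z -> \bar R) : measurable_fun setT th -> unit_fun H ->
    \int[P]_z (phi (th z) * H z) = limn (fun n =>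
      \sum_(r \in range (g n)) (r%:E *
        \int[P]_z ((\1_(g n @^-1` [set r]) (th z))%:E * H z))).
  move=> mth uH; have [mH _] := uH.
  have mgH n : measurable_fun setT (fun z => (g n (th z))%:E * H z).
    apply: emeasurable_funM => //; apply/measurable_EFinP.
    exact: measurableT_comp.
  transitivity (\int[P]_z limn (fun n => (g n (th z))%:E * H z)).
    apply: eq_integral => z _; apply/esym/cvg_lim => //.
    apply: cvgeZr; last exact: cvg_nnsfun_approx.
    exact: unit_fun_fin.
  rewrite monotone_convergence//; last 2 first.
  - by move=> n z _; rewrite mule_ge0 ?lee_fin ?unit_fun_ge0.
  - move=> z _ m n mn; rewrite lee_wpmul2r ?unit_fun_ge0// lee_fin.
    exact/lefP/nd_nnsfun_approx.
  congr (limn _); apply/funext => n.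
  transitivity (\int[P]_z \sum_(r \in range (g n))
      (r%:E * ((\1_(g n @^-1` [set r]) (th z))%:E * H z))).
    apply: eq_integral => z _.
    rewrite {1}fimfunE -fsumEFin// fsbig_finite//= [in RHS]fsbig_finite//=.
    rewrite ge0_sume_distrl//.
      by apply: eq_bigr => r _; rewrite EFinM muleA.
    by move=> r _; rewrite EFinM nnfun_muleindic_ge0.
  rewrite ge0_integral_fsum//.
  - apply: eq_fsbigr => r /[!inE] -[t _ <-].
    by rewrite ge0_integralZl//; [case: (uI mth uH (mg n (g n t)))|
      move=> z _; exact: unit_fun_ge0 _ (uI mth uH (mg n (g n t)))|rewrite lee_fin].
  - move=> r; apply: emeasurable_funM => //.
    by case: (uI mth uH (mg n r)).
  - by move=> r z _; rewrite muleA mule_ge0 ?nnfun_muleindic_ge0 ?unit_fun_ge0.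
rewrite !approx//; congr (limn _); apply/funext => n.
apply: eq_fsbigr => r _; congr (_ * _); exact: indic_eq.
Qed.

End equal_weighted_images.

Lemma integral_indic_mul {R : realType} d (T : measurableType d)
    (P : {measure set T -> \bar R}) (D : set T) (a : T -> \bar R) :
  \int[P]_(t in D) a t = \int[P]_t ((\1_D t)%:E * a t).
Proof.
rewrite integral_mkcond; apply: eq_integral => t _.
rewrite /patch indicE; case: ifPn => _; first by rewrite mul1e.
by rewrite mul0e.
Qed.

(** * Equality of conditional expectations *)

Section conditional_equality.
Context {R : realType} d (Omega : measurableType d) (P : probability Omega R)
  d' (T : measurableType d') (X : Omega -> T).
Hypothesis mX : measurable_fun setT X.
Implicit Types a b H K : Omega -> \bar R.

(* [a] and [b] have the same conditional expectation given [X]. *)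
Definition cond_eq a b : Prop := forall G : set T, measurable G ->
  \int[P]_(w in X @^-1` G) a w = \int[P]_(w in X @^-1` G) b w.

Lemma eq_cond_eq a a' b b' : a =1 a' -> b =1 b' -> cond_eq a b -> cond_eq a' b'.
Proof. by move=> /funext <- /funext <-. Qed.

(** Test functions replace test sets: [a] and [b] are two weights on the image under the same map
    [X], and the pi-system consists of all measurable sets. *)
Lemma cond_eq_integral a b (psi : T -> \bar R) :
  unit_fun a -> unit_fun b -> cond_eq a b ->
  measurable_fun setT psi -> (forall t, 0 <= psi t) ->
  \int[P]_w (psi (X w) * a w) = \int[P]_w (psi (X w) * b w).
Proof.
move=> ua ub ab mpsi psi0.
apply: (@eq_weighted_images _ _ _ _ _ _ _ _ _ X X a b mX mX ua ub measurable) => //.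
- by rewrite sigma_algebra_id//; exact: sigma_algebra_measurable.
- by move=> A B mA mB; exact: measurableI.
move=> C mC; rewrite -[LHS](integral_indic_mul P (X @^-1` C)).
by rewrite -[RHS](integral_indic_mul P (X @^-1` C)) ab.
Qed.

(* Given [X], weighted by [H], the variable [Y] has the law of [j (X, e)] for
   [e] of law [Q], weighted by [K]. *)
Lemma cond_eq_freeze dE (E : measurableType dE) dE' (E' : measurableType dE')
    (Q : probability E' R) (j : T * E' -> E) (Y : Omega -> E) H K :
  measurable_fun setT j -> measurable_fun setT Y ->
  unit_fun H -> unit_fun K ->
  (forall A, measurable A ->
    cond_eq (fun w => (\1_A (Y w))%:E * H w)
      (fun w => (\int[Q]_e (\1_A (j (X w, e)))%:E) * K w)) ->
  forall phi : T * E -> \bar R, unit_fun phi ->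
    cond_eq (fun w => phi (X w, Y w) * H w)
      (fun w => (\int[Q]_e phi (X w, j (X w, e))) * K w).
Proof.
move=> mj mY uH uK HA phi uphi G mG.
rewrite [LHS]integral_indic_mul [RHS]integral_indic_mul.
have mth2 : measurable_fun setT (fun z : Omega * E' => (X z.1, j (X z.1, z.2))).
  have m1 : measurable_fun setT (fun z : Omega * E' => X z.1).
    exact: (measurableT_comp mX).
  apply: measurable_fun_pair => //; apply: (measurableT_comp mj).
  exact: measurable_fun_pair.
(* By Tonelli the mean over [e] inside the integral over [w] becomes one integral for the product
   measure, where [Y] can be compared with [j]. *)
have iter (f : T * E -> \bar R) (G' : set T) : unit_fun f -> measurable G' ->
    \int[P]_w ((\1_(X @^-1` G') w)%:E * ((\int[Q]_e f (X w, j (X w, e))) * K w)) =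
    \int[(P \x Q)%E]_z
      ((\1_G' (X z.1))%:E * f (X z.1, j (X z.1, z.2)) * K z.1).
  move=> uf mG'; have [mf f0] := uf; have [mK K0] := uK.
  have mff := unit_fun_comp uf mth2.
  have ug := unit_funM (unit_funM (unit_fun_comp (unit_fun_indic mG')
     (measurableT_comp mX measurable_fst)) mff) (unit_fun_comp uK measurable_fst).
  rewrite fubini_tonelli1.
  - apply: eq_integral => w _; rewrite /fubini_F/=.
    have ufw : unit_fun (fun e => f (X w, j (X w, e))).
      split; last by move=> e; exact: f0.
      exact: (measurableT_comp mff.1 (pair1_measurable w)).
    have [mfw _] := ufw.
    transitivity (\int[Q]_e (f (X w, j (X w, e)) * ((\1_G' (X w))%:E * K w))).
      rewrite ge0_integralZr//; first by rewrite muleCA.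
        by move=> e _; exact: unit_fun_ge0 _ ufw.
      by rewrite mule_ge0 ?lee_fin// unit_fun_ge0.
    by apply: eq_integral => e _; rewrite muleCA muleA.
  - by case: ug.
  - by move=> z; exact: unit_fun_ge0 _ ug.
have u1A A : measurable A -> unit_fun (fun e : E => (\1_A e)%:E : \bar R).
  exact: unit_fun_indic.
rewrite iter//.
transitivity (\int[P]_w (((\1_G (X w))%:E * phi (X w, Y w)) * H w)).
  by apply: eq_integral => w _; rewrite muleA.
(* The pi-system is that of measurable rectangles A x B: there the claim is [HA] for B, tested on
   the event that [X] lies in A. *)
have := @eq_weighted_images _ _ _ _ _ _ _ P (P \x Q)%E
  (fun w => (X w, Y w)) (fun z => (X z.1, j (X z.1, z.2))) H (fun z => K z.1)
  _ mth2 uH (unit_fun_comp uK measurable_fst)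
  _ (measurable_prod_measurableType T E) _ _ _
  (fun t => (\1_G t.1)%:E * phi t).
apply.
- exact: measurable_fun_pair.
- move=> _ _ [A1 mA1 [A2 mA2 <-]] [B1 mB1 [B2 mB2 <-]].
  exists (A1 `&` B1); first exact: measurableI.
  exists (A2 `&` B2); first exact: measurableI.
  by rewrite setXI.
- by exists setT => //; exists setT => //; rewrite setXTT.
- move=> _ [A mA [B mB <-]].
  have indX (t : T) (e : E) :
      (\1_(A `*` B) (t, e))%:E = (\1_A t)%:E * (\1_B e)%:E :> \bar R.
    rewrite -EFinM !indicE in_setX/=.
    by case: (_ \in _); case: (_ \in _); rewrite /= ?(mulr1, mulr0).
  under eq_integral do rewrite indX -muleA.
  under [RHS]eq_integral do rewrite indX.
  have := iter (fun t => (\1_B t.2)%:E) A (unit_fun_comp (u1A _ mB) measurable_snd) mA.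
  move=> <-; rewrite -[LHS](integral_indic_mul P (X @^-1` A)).
  by rewrite -[RHS](integral_indic_mul P (X @^-1` A)); exact: HA.
- apply: emeasurable_funM; last by case: uphi.
  exact: (unit_fun_comp (unit_fun_indic mG) measurable_fst).1.
- by move=> t; rewrite mule_ge0 ?lee_fin ?unit_fun_ge0.
Qed.

(* The factors are exchanged one at a time, so that it suffices to pass from
   [S] to [S'] in one factor, the product of the others being absorbed in the
   weights [H] and [K]. *)
Lemma cond_eq_prod (J : eqType) (s : seq J)
    (S S' : J -> (Omega -> \bar R) -> (Omega -> \bar R) -> Prop) :
  uniq s ->
  (forall j a b, S j a b -> unit_fun a /\ unit_fun b) ->
  (forall j a b, S' j a b -> unit_fun a /\ unit_fun b) ->
  (forall j H K, j \in s -> unit_fun H -> unit_fun K ->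
    (forall a b, S j a b -> cond_eq (fun w => a w * H w) (fun w => b w * K w)) ->
    forall a b, S' j a b -> cond_eq (fun w => a w * H w) (fun w => b w * K w)) ->
  (forall a b : J -> Omega -> \bar R, (forall j, j \in s -> S j (a j) (b j)) ->
    cond_eq (fun w => \prod_(j <- s) a j w) (fun w => \prod_(j <- s) b j w)) ->
  forall a b : J -> Omega -> \bar R, (forall j, j \in s -> S' j (a j) (b j)) ->
    cond_eq (fun w => \prod_(j <- s) a j w) (fun w => \prod_(j <- s) b j w).
Proof.
move=> us uS uS' step base.
(* [s'] lists the factors still to be exchanged. Those already exchanged sit in the weights [H] and
   [K], which therefore vary in the induction. *)
suff gen : forall s' H K, uniq s' -> {subset s' <= s} -> unit_fun H -> unit_fun K ->
    (forall a b : J -> Omega -> \bar R, (forall j, j \in s' -> S j (a j) (b j)) ->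
      cond_eq (fun w => \prod_(j <- s') a j w * H w)
              (fun w => \prod_(j <- s') b j w * K w)) ->
    forall a b : J -> Omega -> \bar R, (forall j, j \in s' -> S' j (a j) (b j)) ->
      cond_eq (fun w => \prod_(j <- s') a j w * H w)
              (fun w => \prod_(j <- s') b j w * K w).
  move=> a b Sab.
  apply: eq_cond_eq (gen s (cst 1) (cst 1) us (fun=> id) (unit_fun_cst1 _)
    (unit_fun_cst1 _) _ a b Sab).
  - by move=> w; rewrite /= mule1.
  - by move=> w; rewrite /= mule1.
  move=> a' b' Sab'; apply: eq_cond_eq (base _ _ Sab').
  - by move=> w; rewrite /= mule1.
  - by move=> w; rewrite /= mule1.
elim=> [|j s' ih] H K; first by move=> _ _ _ _ h a b _; exact: h.
move=> /=/andP[js' us'] ss' uH uK h a b Sab.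
have [uaj ubj] := uS' _ _ _ (Sab j (mem_head _ _)).
have Sab's i : i \in s' -> S' i (a i) (b i).
  by move=> is'; apply: Sab; rewrite inE is' orbT.
apply: eq_cond_eq (ih (fun w => a j w * H w) (fun w => b j w * K w) us' _ _ _ _
  a b Sab's).
- by move=> w; rewrite big_cons muleCA muleA.
- by move=> w; rewrite big_cons muleCA muleA.
- by move=> i is'; apply: ss'; rewrite inE is' orbT.
- exact: unit_funM.
- exact: unit_funM.
move=> a' b' Sab'.
have upH : unit_fun (fun w => (\prod_(i <- s') a' i w) * H w).
  apply: unit_funM => //; apply: unit_fun_prod => i is'.
  by have [] := uS _ _ _ (Sab' i is').
have upK : unit_fun (fun w => (\prod_(i <- s') b' i w) * K w).
  apply: unit_funM => //; apply: unit_fun_prod => i is'.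
  by have [] := uS _ _ _ (Sab' i is').
apply: eq_cond_eq (step j _ _ (ss' _ (mem_head _ _)) upH upK _ _ _
  (Sab j (mem_head _ _))).
- by move=> w; rewrite muleCA.
- by move=> w; rewrite muleCA.
move=> aj bj Sj.
(* The family takes the pair under exchange at [j] and the old factors elsewhere. Its product splits
   because [j] is not in [s']. *)
have big_if (c : J -> Omega -> \bar R) cj w :
    \prod_(i <- j :: s') (if i == j then cj else c i) w =
    cj w * \prod_(i <- s') c i w.
  rewrite big_cons eqxx; congr (_ * _); rewrite !big_seq.
  apply: eq_bigr => i is'; case: eqP => // ij.
  by move: js'; rewrite -ij is'.
apply: eq_cond_eq (h (fun i => if i == j then aj else a' i)
                     (fun i => if i == j then bj else b' i) _).
- by move=> w; rewrite big_if muleA.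
- by move=> w; rewrite big_if muleA.
move=> i; rewrite inE; case: eqP => [->//|_]/=; exact: Sab'.
Qed.

End conditional_equality.

(** * Sums over a countable set of labels *)

Section countable_sums.
Context {R : realType} {T : countType}.
Variable V : set T.

(** Finite duplicate-free lists that exhaust [V]: they reduce infinitely many labels to finite
    families, the only ones whose joint law is prescribed. *)
Definition first_elements (k : nat) : seq T :=
  [seq v <- pmap (@pickle_inv T) (iota 0 k) | v \in V].

Lemma first_elements_uniq k : uniq (first_elements k).
Proof.
apply: filter_uniq; apply: (@pmap_uniq _ _ _ pickle); last exact: iota_uniq.
exact: pickle_invK.
Qed.

Lemma first_elements_sub k v : v \in first_elements k -> V v.
Proof. by rewrite mem_filter => /andP[/set_mem]. Qed.

Lemma first_elements_cvg (a : T -> \bar R) : (forall v, 0 <= a v) ->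
  \sum_(v <- first_elements k) a v @[k --> \oo] --> \esum_(v in V) a v.
Proof.
move=> a0.
(* The summands are listed by code, with 0 at the codes of no element of [V]. *)
pose a' i := if pickle_inv i is Some v then (if v \in V then a v else 0) else 0.
have a'0 i : 0 <= a' i by rewrite /a'; case: pickle_inv => // v; case: ifP.
have -> : (fun k => \sum_(v <- first_elements k) a v) =
    (fun k => \sum_(0 <= i < k) a' i).
  apply/funext => k; rewrite /first_elements big_filter big_mkcond/=.
  rewrite /index_iota subn0; elim: (iota 0 k) => [|i s ih]; first by rewrite !big_nil.
  rewrite /= big_cons -ih {1}/a'; case: (pickle_inv i) => [v|]/=.
    by rewrite big_cons.
  by rewrite add0e.
have -> : \esum_(v in V) a v = \sum_(i <oo) a' i.
  rewrite nneseries_esumT// esum_mkcond.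
  have -> : \esum_(i in setT) a' i = \esum_(i in range (@pickle T)) a' i.
    rewrite [RHS]esum_mkcond; apply: eq_esum => i _.
    case: ifPn => // /negP h; rewrite /a'; case E : pickle_inv => [v|//].
    exfalso; apply: h; rewrite inE; exists v => //.
    by have := @pickle_invK T i; rewrite E.
  rewrite esum_image; last first.
    by move=> x y _ _ /(congr1 (@pickle_inv T)); rewrite !pickleK_inv => -[].
  by apply: eq_esum => v _; rewrite /a' pickleK_inv.
exact: is_cvg_nneseries.
Qed.

Context d (Omega : measurableType d).

Lemma measurable_esum (a : T -> Omega -> \bar R) :
  (forall v, measurable_fun setT (a v)) -> (forall v w, 0 <= a v w) ->
  measurable_fun setT (fun w => \esum_(v in V) a v w).
Proof.
move=> ma a0; apply: (emeasurable_fun_cvg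
  (fun k w => \sum_(v <- first_elements k) a v w)).
- by move=> k; exact: emeasurable_sum.
- by move=> w _; exact: first_elements_cvg.
Qed.

Lemma unit_fun_nexp_esum (a : T -> Omega -> \bar R) :
  (forall v, measurable_fun setT (a v)) -> (forall v w, 0 <= a v w) ->
  unit_fun (fun w => nexp (\esum_(v in V) a v w)).
Proof.
move=> ma a0; apply: unit_fun_nexp; first exact: measurable_esum.
by move=> w; exact: esum_ge0.
Qed.

Lemma integral_nexp_esum (P : probability Omega R) (psi : Omega -> \bar R)
    (a : T -> Omega -> \bar R) :
  unit_fun psi ->
  (forall v, measurable_fun setT (a v)) -> (forall v w, 0 <= a v w) ->
  \int[P]_w (psi w * \prod_(v <- first_elements k) nexp (a v w)) @[k --> \oo] -->
  \int[P]_w (psi w * nexp (\esum_(v in V) a v w)).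
Proof.
move=> upsi ma a0; have [mpsi _] := upsi.
have up k : unit_fun (fun w => psi w * \prod_(v <- first_elements k) nexp (a v w)).
  by apply: unit_funM => //; apply: unit_fun_prod => v _; exact: unit_fun_nexp.
have ue : unit_fun (fun w => psi w * nexp (\esum_(v in V) a v w)).
  by apply: unit_funM => //; exact: unit_fun_nexp_esum.
apply: (@dominated_cvg _ _ _ P setT measurableT _ _ (cst 1)) => //.
- by move=> k; case: (up k).
- move=> w _; apply: cvgeZl; first exact: unit_fun_fin.
  under eq_fun do rewrite -nexp_sum//.
  apply: nexp_cvg; last exact: first_elements_cvg.
    by move=> k; exact: sume_ge0.
  exact: esum_ge0.
- exact: finite_measure_integrable_cst.
- by move=> k w _; rewrite gee0_abs ?(unit_fun_ge0 _ (up k))// (unit_fun_le1 _ (up k)).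
Qed.

(** Both sides are limits along [first_elements], so an identity for finite families of labels
    extends to [V]. *)
Lemma eq_integral_nexp_esum (P : probability Omega R) (psi : Omega -> \bar R)
    (a b : T -> Omega -> \bar R) :
  unit_fun psi ->
  (forall v, measurable_fun setT (a v)) -> (forall v w, 0 <= a v w) ->
  (forall v, measurable_fun setT (b v)) -> (forall v w, 0 <= b v w) ->
  (forall s : seq T, uniq s -> (forall v, v \in s -> V v) ->
    \int[P]_w (psi w * \prod_(v <- s) nexp (a v w)) =
    \int[P]_w (psi w * \prod_(v <- s) nexp (b v w))) ->
  \int[P]_w (psi w * nexp (\esum_(v in V) a v w)) =
  \int[P]_w (psi w * nexp (\esum_(v in V) b v w)).
Proof.
move=> upsi ma a0 mb b0 ab.
have ha := @integral_nexp_esum P _ _ upsi ma a0.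
have hb := @integral_nexp_esum P _ _ upsi mb b0.
have habk k := ab _ (first_elements_uniq k) (@first_elements_sub k).
move: ha; rewrite (_ : (fun k => _) = (fun k =>
    \int[P]_w (psi w * \prod_(v <- first_elements k) nexp (b v w)))).
  by move=> ha; exact: (cvg_unique _ ha hb).
by apply/funext => k; exact: habk.
Qed.

End countable_sums.

(** * Poisson masses and their Laplace transform *)

Section poisson_mass.
Context {R : realType}.

(** Mean 0 is a case of its own, where the law is the Dirac mass at 0. *)
Lemma poisson_massE (m : \bar R) k : poisson_mass m k =
  if m \is a fin_num then
    if (0 < fine m)%R then (poisson_pmf (fine m) k)%:E else (k == 0%N)%:R%:E
  else 0.
Proof.
case: m => [r| |]//=; rewrite /poisson_prob; case: ifPn => r0.
  by rewrite esum_set1// lee_fin poisson_pmf_ge0.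
rewrite diracE; congr (_%:R%:E); congr nat_of_bool.
by apply/idP/eqP => [/set_mem/= ->|->] //; exact/mem_set.
Qed.

Lemma poisson_mass_ge0 (m : \bar R) k : 0 <= poisson_mass m k.
Proof.
rewrite poisson_massE; case: ifPn => // _; case: ifPn => _; rewrite lee_fin//.
exact: poisson_pmf_ge0.
Qed.

Lemma measurable_poisson_mass d (T : measurableType d) (m : T -> \bar R) k :
  measurable_fun setT m -> measurable_fun setT (fun t => poisson_mass (m t) k).
Proof.
move=> mm; apply: (measurableT_comp (f := fun x : \bar R => poisson_mass x k)) => //.
rewrite (_ : (fun x => _) = (fun x => if x \is a fin_num then
    if (0 < fine x)%R then (poisson_pmf (fine x) k)%:E else (k == 0%N)%:R%:E
  else 0)); last by apply/funext => x; exact: poisson_massE.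
apply: measurable_fun_ifT => //.
  apply: (measurable_fun_bool true); exact/emeasurable_fin_num.
apply: measurable_fun_ifT => //.
  exact: measurable_fun_ltr.
apply/measurable_EFinP.
apply: (measurableT_comp (f := fun x : R => poisson_pmf x k)) => //.
exact: measurable_poisson_pmf.
Qed.

(** For a positive finite mean [r] this is the exponential series at [expR (- a) * r]. For an
    infinite mean every finite count has mass 0, and the right-hand side vanishes too because [a] is
    positive. *)
Lemma poisson_mass_laplace (m : \bar R) (a : R) : 0 <= m -> (0 < a)%R ->
  \sum_(k <oo) ((expR (- (a * k%:R)))%:E * poisson_mass m k) =
  nexp ((1 - expR (- a))%:E * m).
Proof.
move=> m0 a0; have ea1 : (0 < 1 - expR (- a))%R.
  by rewrite subr_gt0 -[ltRHS]expR0 ltr_expR oppr_lt0.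
case: m m0 => [r| |]// r0; last first.
  rewrite gt0_muley ?lte_fin// nexpy.
  by apply: eseries0 => k _ _; rewrite mule0.
rewrite lee_fin le_eqVlt in r0; case/predU1P: r0 => [<-|r0].
  rewrite mule0 nexp0.
  rewrite (@nneseriesD1 _ _ 0%N)//; last first.
    by move=> k _; rewrite mule_ge0 ?poisson_mass_ge0// lee_fin expR_ge0.
  rewrite eseries0 ?adde0; last first.
    by move=> k _ /negPf k0; rewrite poisson_massE/= ltxx k0 mule0.
  by rewrite poisson_massE/= ltxx mulr0 oppr0 expR0 ?eqxx mule1.
transitivity ((expR (- r))%:E * (expR (expR (- a) * r))%:E); last first.
  by rewrite -EFinM -expRD /nexp/= mulrBl mul1r opprB addrC.
transitivity (\sum_(k <oo)
    ((expR (- r))%:E * ((k`!%:R)^-1 * (expR (- a) * r) ^+ k)%:E)).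
  apply: eq_eseriesr => k _; rewrite poisson_massE/= r0 -!EFinM; congr (_%:E).
  rewrite /poisson_pmf r0 exprMn -expRM_natl mulrN [(k%:R * a)%R]mulrC.
  by ring.
rewrite nneseriesZl/=; last first.
  move=> k _; rewrite lee_fin mulr_ge0// exprn_ge0// mulr_ge0 ?expR_ge0//.
  exact: ltW.
congr *%E; rewrite expRE -EFin_lim; last first.
  rewrite /pseries/=; under eq_fun do rewrite mulrC.
  exact: is_cvg_series_exp_coeff.
apply/congr_lim/funext => n/=; rewrite /pseries/= /series/= -sumEFin//.
Qed.

End poisson_mass.

(** * Conditionally Poisson counts *)

Section conditional_poisson.
Context {R : realType} d (Omega : measurableType d) (P : probability Omega R)
  d' (T : measurableType d') (X : Omega -> T).
Hypothesis mX : measurable_fun setT X.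

Definition nat_or_infinite (n : \bar R) : Prop :=
  n = +oo \/ exists k : nat, n = k%:R%:E.

Lemma nat_or_infinite_ge0 (n : \bar R) : nat_or_infinite n -> 0 <= n.
Proof. by case=> [->//|[k ->]]; rewrite lee_fin. Qed.

(** The value +oo contributes exp(-oo) = 0 since [a] is positive, so a sum over finite values
    suffices. *)
Lemma nexp_nat_or_infinite (n : \bar R) (a : R) : nat_or_infinite n -> (0 < a)%R ->
  nexp (a%:E * n) =
  \sum_(k <oo) ((expR (- (a * k%:R)))%:E * (\1_[set k%:R%:E] n)%:E).
Proof.
move=> [->|[k ->]] a0.
  rewrite gt0_muley ?lte_fin// nexpy; apply/esym/eseries0 => k _ _.
  by rewrite indicE memNset ?mule0.
rewrite (@nneseriesD1 _ _ k)//.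
rewrite eseries0 ?adde0; last first.
  move=> i _ /negPf ik; rewrite indicE memNset ?mule0//= => -[] /eqP.
  by rewrite eqr_nat eq_sym ik.
by rewrite indicE mem_set// mule1.
Qed.

Let measurable_level (N : Omega -> \bar R) (k : nat) : measurable_fun setT N ->
  measurable (N @^-1` [set k%:R%:E]).
Proof.
by move=> mN; rewrite -[X in measurable X]setTI; apply: mN => //; exact: emeasurable_set1.
Qed.

(** Both exponentials expand as series over the value k of the count with the same coefficients
    exp(-ak), so the hypothesis applies term by term. *)
Lemma cond_eq_poisson_step (N m H K : Omega -> \bar R) (a : R) :
  measurable_fun setT N -> (forall w, nat_or_infinite (N w)) ->
  measurable_fun setT m -> (forall w, 0 <= m w) -> (0 < a)%R ->
  unit_fun H -> unit_fun K ->
  (forall k, cond_eq P X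
    (fun w => (\1_(N @^-1` [set k%:R%:E]) w)%:E * H w)
    (fun w => poisson_mass (m w) k * K w)) ->
  cond_eq P X (fun w => nexp (a%:E * N w) * H w)
              (fun w => nexp ((1 - expR (- a))%:E * m w) * K w).
Proof.
move=> mN Nn mm m0 a0 uH uK HK G mG.
have mXG : measurable (X @^-1` G) by rewrite -[X in measurable X]setTI; exact: mX.
have [mH _] := uH; have [mK _] := uK.
pose c k : R := expR (- (a * k%:R)).
have c0 k : (0 <= c k)%R by exact: expR_ge0.
(* The exchange of series and integral is proved once and used for the indicators and for the
   Poisson masses. *)
have mser (f : nat -> Omega -> \bar R) (L : Omega -> \bar R) : unit_fun L ->
    (forall k, measurable_fun setT (f k)) -> (forall k w, 0 <= f k w) ->
    \int[P]_(w in X @^-1` G) ((\sum_(k <oo) ((c k)%:E * f k w)) * L w) =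
    \sum_(k <oo) ((c k)%:E * \int[P]_(w in X @^-1` G) (f k w * L w)).
  move=> uL mf f0; have [mL _] := uL.
  transitivity (\int[P]_(w in X @^-1` G) \sum_(k <oo) ((c k)%:E * (f k w * L w))).
    apply: eq_integral => w _; rewrite muleC -[L w]fineK ?unit_fun_fin//.
    rewrite -nneseriesZl//; last by move=> k _; rewrite mule_ge0 ?lee_fin.
    by apply: eq_eseriesr => k _; rewrite muleC muleA.
  have mfL k : measurable_fun setT (fun w => f k w * L w).
    exact: emeasurable_funM.
  rewrite integral_nneseries//; last 2 first.
  - by move=> k; apply: measurable_funTS; exact: emeasurable_funM.
  - by move=> k w _; rewrite !mule_ge0 ?lee_fin// unit_fun_ge0.
  apply: eq_eseriesr => k _; rewrite ge0_integralZl ?lee_fin//.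
  - exact: measurable_funTS.
  - by move=> w _; rewrite mule_ge0// unit_fun_ge0.
under eq_integral do rewrite nexp_nat_or_infinite//.
under [RHS]eq_integral do rewrite -poisson_mass_laplace//.
rewrite (mser (fun k w => (\1_(N @^-1` [set k%:R%:E]) w)%:E))//; last first.
  move=> k; apply/measurable_EFinP; apply: measurable_indic.
  exact: measurable_level.
rewrite (mser (fun k w => poisson_mass (m w) k))//; last 2 first.
- by move=> k; exact: measurable_poisson_mass.
- by move=> k w; exact: poisson_mass_ge0.
by apply: eq_eseriesr => k _; rewrite HK.
Qed.

(** Joint masses determine the joint Laplace transform: [cond_eq_prod] exchanges one count at a
    time, each by the preceding lemma. *)
Lemma cond_eq_poisson (J : eqType) (s : seq J) (N m : J -> Omega -> \bar R)
    (a : J -> R) : uniq s ->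
  (forall j, measurable_fun setT (N j)) -> (forall j w, nat_or_infinite (N j w)) ->
  (forall j, measurable_fun setT (m j)) -> (forall j w, 0 <= m j w) ->
  (forall j, j \in s -> 0 < a j)%R ->
  (forall k : J -> nat, cond_eq P X
    (fun w => \prod_(j <- s) (\1_(N j @^-1` [set (k j)%:R%:E]) w)%:E)
    (fun w => \prod_(j <- s) poisson_mass (m j w) (k j))) ->
  cond_eq P X (fun w => \prod_(j <- s) nexp ((a j)%:E * N j w))
              (fun w => \prod_(j <- s) nexp ((1 - expR (- a j))%:E * m j w)).
Proof.
move=> us mN Nn mm m0 a0 Nm.
(* [S] pairs the indicator of a level of the count with its Poisson mass; [S'] pairs the
   corresponding Laplace factors. *)
pose S j (f g : Omega -> \bar R) := exists k : nat,
  f = (fun w => (\1_(N j @^-1` [set k%:R%:E]) w)%:E) /\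
  g = (fun w => poisson_mass (m j w) k).
pose S' j (f g : Omega -> \bar R) :=
  [/\ j \in s, f = (fun w => nexp ((a j)%:E * N j w)) &
  g = (fun w => nexp ((1 - expR (- a j))%:E * m j w))].
have N0 j w : 0 <= N j w by exact: nat_or_infinite_ge0.
have ea j : j \in s -> (0 <= 1 - expR (- a j))%R.
  by move=> js; rewrite subr_ge0 -[leRHS]expR0 ler_expR oppr_le0 ltW// a0.
apply: (@cond_eq_prod _ _ _ P _ _ X _ s S S' us).
- move=> j f g [k [-> ->]]; split.
    by apply: unit_fun_indic; exact: measurable_level.
  split; first exact: measurable_poisson_mass.
  move=> w; rewrite poisson_mass_ge0 /=; case: (m j w) => [r| |] /=; rewrite ?lee01//.
  exact: probability_le1.
- move=> j f g [js -> ->]; split; apply: unit_fun_nexp.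
  + by apply: emeasurable_funM.
  + by move=> w; rewrite mule_ge0// lee_fin ltW// a0.
  + by apply: emeasurable_funM.
  + by move=> w; rewrite mule_ge0// lee_fin ea.
- move=> j H K js uH uK HK f g [_ -> ->].
  apply: cond_eq_poisson_step => //; first exact: a0.
  by move=> k; apply: HK; exists k.
- move=> f g fg.
  have /choice[k kP] : forall j, exists k, j \in s ->
      f j = (fun w => (\1_(N j @^-1` [set k%:R%:E]) w)%:E) /\
      g j = (fun w => poisson_mass (m j w) k).
    move=> j; have [js|_] := boolP (j \in s); last by exists 0%N.
    by have [k ?] := fg _ js; exists k.
  apply: eq_cond_eq (Nm k) => w; rewrite big_seq [RHS]big_seq;
    by apply: eq_bigr => j /kP[e1 e2]; rewrite ?e1 ?e2.
- by move=> j js; split.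
Qed.

End conditional_poisson.

Definition cost_fun {R : realType} d (T : measurableType d) (c : T -> \bar R) : Prop :=
  measurable_fun setT c /\ forall t, 0 <= c t.

Lemma measurable_ge0_integral {R : realType} d1 d2 (T1 : measurableType d1)
    (T2 : measurableType d2) (m : {sigma_finite_measure set T2 -> \bar R})
    (f : T1 -> T2 -> \bar R) :
  measurable_fun setT (fun z : T1 * T2 => f z.1 z.2) ->
  (forall x y, 0 <= f x y) -> measurable_fun setT (fun x => \int[m]_y f x y).
Proof.
move=> mf f0.
exact: (measurable_fun_fubini_tonelli_F (m2 := m) (fun z => f z.1 z.2)).
Qed.

(** * Integrals over the plane *)

Section planar_integrals.
Context {R : realType}.
Local Notation leb := (@lebesgue_measure R).

Lemma integral_planar (f : R * R -> \bar R) :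
  measurable_fun setT f -> (forall p, 0 <= f p) ->
  \int[leb \x leb]_p f p = \int[leb]_s \int[leb]_z f (s, z).
Proof.
move=> mf f0.
exact: (@fubini_tonelli1 _ _ _ _ _ leb leb f mf f0).
Qed.

Lemma measurable_planar_integral d (T : measurableType d)
    (f : T -> R * R -> \bar R) :
  measurable_fun setT (fun z : T * (R * R) => f z.1 z.2) ->
  (forall x y, 0 <= f x y) -> measurable_fun setT (fun x => \int[leb \x leb]_y f x y).
Proof.
move=> mf f0.
rewrite (_ : (fun x => _) = (fun x => \int[leb]_s \int[leb]_z f x (s, z))); last first.
  apply/funext => x; rewrite integral_planar//.
  exact: (measurableT_comp mf (pair1_measurable x)).
apply: (@measurable_ge0_integral R _ _ T _ leb (fun x s => \int[leb]_z f x (s, z))).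
  apply: (@measurable_ge0_integral R _ _ _ _ leb (fun xs z => f xs.1 (xs.2, z))) => //.
  have m3 : measurable_fun setT (fun z : (T * R) * R => f z.1.1 (z.1.2, z.2)).
    have mg : measurable_fun setT (fun z : (T * R) * R => (z.1.1, (z.1.2, z.2))).
      apply: measurable_fun_pair; first exact: measurableT_comp.
      by apply: measurable_fun_pair => //; exact: measurableT_comp.
    exact: (measurableT_comp mf mg).
  exact: m3.
by move=> x s; exact: integral_ge0.
Qed.

End planar_integrals.

Lemma indic_bigcap_seq {R : realType} (T : Type) (J : choiceType) (s : seq J)
    (D : J -> set T) t :
  (\1_(\bigcap_(j in [set` s]) D j) t)%:E = \prod_(j <- s) (\1_(D j) t)%:E :> \bar R.
Proof.
rewrite bigcap_seq; elim: s => [|j s ih]; first by rewrite !big_nil indicT.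
by rewrite !big_cons indicI EFinM -ih.
Qed.

Lemma setI_integral_prod {R : realType} d (Omega : measurableType d)
    (P : probability Omega R) (J : choiceType) (s : seq J) (D : J -> set Omega) G :
  measurable G -> (forall j, j \in s -> measurable (D j)) ->
  \int[P]_(w in G) (\prod_(j <- s) (\1_(D j) w)%:E) =
  P (G `&` \bigcap_(j in [set` s]) D j).
Proof.
move=> mG mD.
under eq_integral do rewrite -indic_bigcap_seq.
rewrite integral_indic// 1?setIC//.
by apply: fin_bigcap_measurable => // j /= /mD.
Qed.

(** * Simple functions through their level sets *)

Section simple_values.
Context {R : realType} d (T : measurableType d) (g : {nnsfun T >-> R}).

(** The value 0 is left out because the Laplace transform of a Poisson count is taken at positive
    exponents. It contributes nothing to a function vanishing at 0. *)
Definition positive_values : seq R :=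
  [seq r <- finmap.enum_fset (fset_set (range g)) | (0 < r)%R].

Lemma positive_values_uniq : uniq positive_values.
Proof. by rewrite filter_uniq// finmap.fset_uniq. Qed.

Lemma positive_values_gt0 r : r \in positive_values -> (0 < r)%R.
Proof. by rewrite mem_filter => /andP[]. Qed.

Lemma nnsfun_comp_sum (F : R -> \bar R) t : F 0%R = 0 ->
  F (g t) = \sum_(r <- positive_values) (F r * (\1_(g @^-1` [set r]) t)%:E).
Proof.
move=> F0; have [gt0|] := eqVneq (g t) 0%R.
  rewrite gt0 F0 big_seq big1// => r /positive_values_gt0 r0.
  rewrite indicE memNset ?mule0//= gt0 => r0'.
  by move: r0; rewrite -r0' ltxx.
move=> gt0; have gtin : g t \in positive_values.
  rewrite mem_filter lt_neqAle eq_sym gt0 /= fun_ge0 /=.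
  by rewrite in_fset_set ?inE//; exists t.
rewrite (bigD1_seq (g t))//= ?positive_values_uniq//.
rewrite indicE mem_set// mule1 big1 ?adde0// => r rg.
by rewrite indicE memNset ?mule0//= => e; rewrite e eqxx in rg.
Qed.

End simple_values.

Lemma integral_monotone_cvg {R : realType} d (T : measurableType d)
    (m : {measure set T -> \bar R}) (f : nat -> T -> \bar R) (g : T -> \bar R) :
  (forall n, measurable_fun setT (f n)) -> (forall n t, 0 <= f n t) ->
  (forall t, nondecreasing_seq (f^~ t)) ->
  (forall t, f n t @[n --> \oo] --> g t) ->
  \int[m]_t f n t @[n --> \oo] --> \int[m]_t g t.
Proof.
move=> mf f0 ndf fg.
rewrite (_ : \int[m]_t g t = \int[m]_t limn (f^~ t)).
  by apply: cvg_monotone_convergence.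
by apply: eq_integral => t _; apply/esym/cvg_lim.
Qed.

(** Monotone convergence for the counting measure. *)
Lemma nneseries_monotone_cvg {R : realType} (f : nat -> nat -> \bar R)
    (g : nat -> \bar R) :
  (forall n i, 0 <= f n i) -> (forall i, nondecreasing_seq (f^~ i)) ->
  (forall i, f n i @[n --> \oo] --> g i) ->
  \sum_(i <oo) f n i @[n --> \oo] --> \sum_(i <oo) g i.
Proof.
move=> f0 ndf fg.
have g0 i : 0 <= g i.
  rewrite -(cvg_lim _ (fg i))//; apply: lime_ge; last exact: nearW.
  by apply/cvg_ex; exists (g i).
rewrite -ge0_integral_count//.
rewrite (_ : (fun n => _) = (fun n => \int[@counting nat R]_i f n i)); last first.
  by apply/funext => n; rewrite ge0_integral_count.
exact: integral_monotone_cvg.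
Qed.

Lemma cvg_integral_prod_nexp {R : realType} d (T : measurableType d)
    (P : probability T R) (D : set T) (J : eqType) (s : seq J)
    (a : nat -> J -> T -> \bar R) (b : J -> T -> \bar R) :
  measurable D ->
  (forall n j, measurable_fun setT (a n j)) -> (forall n j t, 0 <= a n j t) ->
  (forall j, measurable_fun setT (b j)) -> (forall j t, 0 <= b j t) ->
  (forall j t, a n j t @[n --> \oo] --> b j t) ->
  \int[P]_(t in D) (\prod_(j <- s) nexp (a n j t)) @[n --> \oo] -->
  \int[P]_(t in D) (\prod_(j <- s) nexp (b j t)).
Proof.
move=> mD ma a0 mb b0 ab.
have ua n : unit_fun (fun t => \prod_(j <- s) nexp (a n j t)).
  by apply: unit_fun_prod => j _; exact: unit_fun_nexp.
have ub : unit_fun (fun t => \prod_(j <- s) nexp (b j t)).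
  by apply: unit_fun_prod => j _; exact: unit_fun_nexp.
apply: (@dominated_cvg _ _ _ P D mD _ _ (cst 1)) => //.
- by move=> n; apply: measurable_funTS; case: (ua n).
- move=> t Dt.
  under eq_fun do rewrite -nexp_sum//.
  rewrite -nexp_sum//; apply: nexp_cvg.
  + by move=> n; exact: sume_ge0.
  + exact: sume_ge0.
  + by apply: cvg_nnesum => // j _; exact: nearW.
- exact: finite_measure_integrable_cst.
- by move=> n t _; rewrite gee0_abs ?(unit_fun_ge0 _ (ua n))// (unit_fun_le1 _ (ua n)).
Qed.

Section freeze_prod.
Context {R : realType} d (Omega : measurableType d) (P : probability Omega R)
  d' (T : measurableType d') (X : Omega -> T).
Hypothesis mX : measurable_fun setT X.
Context dE (E : measurableType dE) dE' (E' : measurableType dE')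
  (Q : probability E' R).

(** Carries independence from product sets to products of functions of [X] and [Y v]. It serves
    twice: for the marks, where [j v] is the second projection, and for the lifetimes, where [j v]
    reads [J] at the location of [v]. *)
Lemma cond_eq_freeze_prod (L : eqType) (s : seq L) (Y : L -> Omega -> E)
    (j : L -> T * E' -> E) (phi : L -> T * E -> \bar R) :
  uniq s ->
  (forall v, v \in s -> measurable_fun setT (Y v)) ->
  (forall v, v \in s -> measurable_fun setT (j v)) ->
  (forall v, v \in s -> unit_fun (phi v)) ->
  (forall A : L -> set E, (forall v, measurable (A v)) ->
    cond_eq P X (fun w => \prod_(v <- s) (\1_(A v) (Y v w))%:E)
      (fun w => \prod_(v <- s) \int[Q]_e (\1_(A v) (j v (X w, e)))%:E)) ->
  cond_eq P X (fun w => \prod_(v <- s) phi v (X w, Y v w))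
    (fun w => \prod_(v <- s) \int[Q]_e phi v (X w, j v (X w, e))).
Proof.
move=> us mY mj uphi YA.
have umean (f : T * E -> \bar R) v : v \in s -> unit_fun f ->
    unit_fun (fun w => f (X w, Y v w)) /\
    unit_fun (fun w => \int[Q]_e f (X w, j v (X w, e))).
  move=> vs uf; split.
    by apply: (unit_fun_comp uf); apply: measurable_fun_pair => //; exact: mY.
  have ufj : unit_fun (fun z : Omega * E' => f (X z.1, j v (X z.1, z.2))).
    apply: (unit_fun_comp uf); apply: measurable_fun_pair.
      exact: (measurableT_comp mX).
    apply: (measurableT_comp (mj _ vs)); apply: measurable_fun_pair => //.
    exact: (measurableT_comp mX).
  have [mfj f01] := ufj; split.
    apply: (@measurable_ge0_integral _ _ _ _ _ Q (fun w e => f (X w, j v (X w, e)))) => //.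
    by move=> w e; case/andP: (f01 (w, e)).
  move=> w; apply: unit_fun_integral01; split; last by move=> e; exact: (f01 (w, e)).
  exact: (measurableT_comp mfj (pair1_measurable w)).
pose S v (a b : Omega -> \bar R) := v \in s /\ exists A : set E,
  [/\ measurable A, a = (fun w => (\1_A (Y v w))%:E) &
      b = (fun w => \int[Q]_e (\1_A (j v (X w, e)))%:E)].
pose S' v (a b : Omega -> \bar R) := v \in s /\ exists f : T * E -> \bar R,
  [/\ unit_fun f, a = (fun w => f (X w, Y v w)) &
      b = (fun w => \int[Q]_e f (X w, j v (X w, e)))].
apply: (@cond_eq_prod _ _ _ P _ _ X _ s S S' us).
- move=> v a b [vs [A [mA -> ->]]].
  exact: (umean (fun z => (\1_A z.2)%:E) v vs
    (unit_fun_comp (unit_fun_indic mA) measurable_snd)).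
- by move=> v a b [vs [f [uf -> ->]]]; exact: umean.
- move=> v H K vs uH uK HK a b [_ [f [uf -> ->]]].
  apply: (cond_eq_freeze mX (mj v vs) (mY v vs) uH uK _ uf) => A mA.
  by apply: HK; split => //; exists A.
- move=> a b ab.
  have /choice[A AP] : forall v, exists A : set E, measurable A /\ (v \in s ->
      a v = (fun w => (\1_A (Y v w))%:E) /\
      b v = (fun w => \int[Q]_e (\1_A (j v (X w, e)))%:E)).
    move=> v; have [vs|_] := boolP (v \in s); last by exists set0.
    by have [_ [A [mA ? ?]]] := ab v vs; exists A.
  apply: eq_cond_eq (YA A (fun v => (AP v).1)) => w; rewrite big_seq [RHS]big_seq;
    by apply: eq_bigr => v /(AP v).2[e1 e2]; rewrite ?e1 ?e2.
- by move=> v vs; split => //; exists (phi v); split => //; exact: uphi.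
Qed.

End freeze_prod.

(** * Translation invariance of Lebesgue measure *)

Section translation.
Context {R : realType}.
Local Notation leb := (@lebesgue_measure R).

(** By uniqueness of Lebesgue measure it suffices to check half-open intervals. *)
Lemma lebesgue_measure_translation (a : R) (A : set R) : measurable A ->
  pushforward leb ((fun s => s - a)%R : _ -> measurableTypeR R) A = leb A.
Proof.
move=> mA.
have msub : measurable_fun setT (fun s : R => s - a)%R by exact: measurable_funB.
apply/esym/lebesgue_measure_unique => //.
move=> _ [[b c]] _ <- /=; rewrite /pushforward.
rewrite (_ : _ @^-1` _ = `](b + a)%R, (c + a)%R]%classic); last first.
  by apply/seteqP; split => s /=; rewrite !in_itv/= ltrBrDr lerBlDr.
rewrite !lebesgue_measure_itv/= !lte_fin ltrD2r; case: ifP => // _.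
by rewrite -!EFinB; congr (_%:E); ring.
Qed.

Lemma integral_translation (f : R -> \bar R) (a : R) :
  measurable_fun setT f -> (forall s, 0 <= f s) ->
  \int[leb]_s f (s - a)%R = \int[leb]_s f s.
Proof.
move=> mf f0.
have msub : measurable_fun setT
    ((fun s => s - a)%R : measurableTypeR R -> measurableTypeR R).
  by have : measurable_fun setT (fun s : R => s - a)%R by exact: measurable_funB.
have := @ge0_integral_pushforward _ _ (measurableTypeR R) (measurableTypeR R) R
  _ msub leb setT f measurableT mf.
rewrite preimage_setT => <-; last by move=> y _; exact: f0.
apply: eq_measure_integral => //= A mA _.
exact: lebesgue_measure_translation.
Qed.

Lemma planar_integral_translation (f : R * R -> \bar R) (a : R) :
  measurable_fun setT f -> (forall p, 0 <= f p) ->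
  \int[leb \x leb]_p f (p.1 - a, p.2)%R = \int[leb \x leb]_p f p.
Proof.
move=> mf f0.
have msh : measurable_fun setT (fun p : R * R => (p.1 - a, p.2)%R).
  by apply: measurable_fun_pair => //; exact: measurable_funB.
rewrite (@integral_planar R (fun p => f (p.1 - a, p.2)%R))//; last first.
  exact: (measurableT_comp mf msh).
rewrite (integral_planar mf f0).
apply: (integral_translation (f := fun s => \int[leb]_z f (s, z))).
  apply: (@measurable_ge0_integral R _ _ _ _ leb (fun s z => f (s, z))) => //.
  have -> : (fun z => f (z.1, z.2)) = f by apply/funext => -[].
  exact: mf.
by move=> s; exact: integral_ge0.
Qed.

End translation.

(** * Sums over the generations of Ulam-Harris labels *)

Definition size_le n := [set v : seq nat | (size v <= n)%N].
Definition size_lt n := [set v : seq nat | (size v < n)%N].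
Definition size_eq n := [set v : seq nat | size v = n].

Section sums_over_labels.
Context {R : realType}.
Implicit Types a : seq nat -> \bar R.

Lemma esum_size_le a n : (forall v, 0 <= a v) ->
  \esum_(v in size_le n) a v =
  \esum_(v in size_lt n) a v + \esum_(v in size_eq n) a v.
Proof.
move=> a0; rewrite esum_mkcond [X in X + _]esum_mkcond [X in _ + X]esum_mkcond.
rewrite -esumD; last 2 first.
- by move=> v _; case: ifP.
- by move=> v _; case: ifP.
apply: eq_esum => v _.
have -> : (v \in size_le n) = (size v <= n)%N by apply/idP/idP => [/set_mem|/mem_set].
have -> : (v \in size_lt n) = (size v < n)%N by apply/idP/idP => [/set_mem|/mem_set].
have -> : (v \in size_eq n) = (size v == n)%N.
  by apply/idP/eqP => [/set_mem|h]; last exact/mem_set.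
by case: ltngtP; rewrite ?addr0 ?adde0 ?add0e.
Qed.

(** By [rcons], labels of length n + 1 are in bijection with pairs of a parent of length n and an
    index. *)
Lemma esum_size_eqS a n : (forall v, 0 <= a v) ->
  \esum_(v in size_eq n.+1) a v =
  \esum_(v in size_eq n) \sum_(i <oo) a (rcons v i).
Proof.
move=> a0.
rewrite [RHS](eq_esum (b := fun v => \esum_(i in setT) a (rcons v i))); last first.
  by move=> v _; rewrite nneseries_esumT.
rewrite esum_esum//.
apply: (reindex_esum _ _ (fun k : seq nat * nat => rcons k.1 k.2)).
split.
- by move=> [v i] [/= vn _]; rewrite /size_eq/= size_rcons vn.
- by move=> [v i] [v' i'] _ _ /= /rcons_inj[-> ->].
- move=> v; rewrite /size_eq/=; case/lastP: v => // v i.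
  by rewrite size_rcons => -[vn]; exists (v, i).
Qed.

End sums_over_labels.

Lemma size_ltS n : size_lt n.+1 = size_le n.
Proof. by apply/seteqP; split=> v; rewrite /size_lt /size_le/= ltnS. Qed.

Lemma esum_size_lt_cvg {R : realType} (a : seq nat -> \bar R) :
  (forall v, 0 <= a v) ->
  \esum_(v in size_lt n) a v @[n --> \oo] --> \esum_(v in setT) a v.
Proof.
move=> a0.
have -> : (fun n => \esum_(v in size_lt n) a v) =
    (fun n => \sum_(0 <= k < n) \esum_(v in size_eq k) a v).
  apply/funext; elim=> [|n ih].
    rewrite big_geq// (_ : size_lt 0 = set0) ?esum_set0//.
    by apply/seteqP; split=> v.
  by rewrite size_ltS esum_size_le// ih big_nat_recr.
have -> : \esum_(v in setT) a v = \sum_(k <oo) \esum_(v in size_eq k) a v.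
  rewrite nneseries_esumT; last by move=> n; exact: esum_ge0.
  rewrite -esum_bigcupT//; last by move=> k k' _ _ [v [<- <-]].
  by congr esum; apply/seteqP; split=> // v _; exists (size v).
by apply: is_cvg_nneseries => *; exact: esum_ge0.
Qed.

(** * The recursion on generations *)

Section model.
Context {R : realType}.
Local Notation I := (@unit_interval R).
Local Notation leb := (@lebesgue_measure R).
Context {dB : measure_display} {OmegaB : measurableType dB}
  (PB : probability OmegaB R)
  {dJ : measure_display} {OmegaJ : measurableType dJ}
  (PJ : probability OmegaJ R)
  (lambda_oo h : R -> R) (W : R -> R -> R)
  (B : OmegaB -> R -> R -> R) (J : OmegaJ -> R -> R)
  (params : hawkes_parameters PB PJ lambda_oo h W B J).

Let mI : measurable I. Proof. exact: measurable_itv. Qed.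

(** Extensions by zero: the parameters are measurable on [0, 1] and [0, +oo[ only, while random
    positions and integrals range over the whole line or plane. *)
Local Notation B0 :=
  ((fun q : OmegaB * (R * R) => B q.1 q.2.1 q.2.2) \_ (setT `*` (I `*` I))).
Local Notation W0 := ((fun p : R * R => W p.1 p.2) \_ (I `*` I)).
Local Notation h0 := (h \_ `[0%R, +oo[).

(** Here [p] is the pair (delay since the birth of the parent, location of the child). *)
Definition offspring_density (b : OmegaB) (y : R) (p : R * R) : R :=
  (B0 (b, (p.2, y)) * W0 (p.2, y) * h0 p.1)%R.

Lemma offspring_densityE b y p : I y ->
  offspring_density b y p =
  if p \in `[0%R, +oo[ `*` I then (B b p.2 y * W p.2 y * h p.1)%R else 0%R.
Proof.
move=> Iy; rewrite /offspring_density /patch.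
have -> : ((b, (p.2, y)) \in setT `*` (I `*` I)) = (p.2 \in I).
  by apply/idP/idP => /set_mem/= h1; apply/mem_set => //; case: h1 => _ [].
have -> : ((p.2, y) \in I `*` I) = (p.2 \in I).
  by apply/idP/idP => /set_mem/= h1; apply/mem_set => //; case: h1.
rewrite in_setX; case: (p.2 \in I); rewrite ?andbT ?andbF ?mul0r//=.
by case: ifP; rewrite ?mulr0.
Qed.

Lemma offspring_density_ge0 b y p : (0 <= offspring_density b y p)%R.
Proof.
rewrite /offspring_density !mulr_ge0// /patch; case: ifPn => // /set_mem/=.
- by move=> [_ [? ?]]; exact: (B_ge0 params).
- by move=> [? ?]; exact: (W_ge0 params).
- by rewrite in_itv/= andbT => ?; exact: (h_ge0 params).
Qed.

Lemma measurable_offspring_density d (T : measurableType d)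
    (b : T -> OmegaB) (y : T -> R) (p : T -> R * R) :
  measurable_fun setT b -> measurable_fun setT y -> measurable_fun setT p ->
  measurable_fun setT (fun t => offspring_density (b t) (y t) (p t)).
Proof.
move=> mb my mp.
have mp1 : measurable_fun setT (fun t => (p t).1) by exact: measurableT_comp.
have mp2 : measurable_fun setT (fun t => (p t).2) by exact: measurableT_comp.
have mpy : measurable_fun setT (fun t => ((p t).2, y t)).
  exact: measurable_fun_pair.
apply: measurable_funM; first apply: measurable_funM.
- apply: (measurableT_comp (f := B0)).
    apply/(measurable_restrictT _ _).1; last exact: (B_measurable params).
    by apply: measurableX => //; exact: measurableX.
  exact: measurable_fun_pair.
- apply: (measurableT_comp (f := W0)) => //.
  apply/(measurable_restrictT _ _).1; last exact: (W_measurable params).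
  exact: measurableX.
- apply: (measurableT_comp (f := h0)) => //.
  apply/(measurable_restrictT _ _).1 => //.
  have /integrableP[] := h_L1 params.
  by move/measurable_EFinP.
Qed.

(* [c (z, t)] is a cost carried by an event at location [z], [t] units of time
   before the horizon. *)
Definition offspring_weight (c : R * R -> \bar R) (t : R) (p : R * R) : \bar R :=
  if (p.1 <= t)%R then 1 - nexp (c (p.2, (t - p.1)%R)) else 0.

(** Exponent in the Laplace functional of a Poisson process, for the offspring of an event with mark
    [b], location [y] and time left [t]. *)
Definition offspring_rate (c : R * R -> \bar R) (b : OmegaB) (y t : R) : \bar R :=
  \int[leb \x leb]_p (offspring_weight c t p * (offspring_density b y p)%:E).

Definition offspring_laplace (c : R * R -> \bar R) (q : R * R) : \bar R :=
  \int[PB]_b nexp (offspring_rate c b q.1 q.2).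

Lemma sub1_nexp_ge0 (x : \bar R) : 0 <= x -> 0 <= 1 - nexp x.
Proof. by move=> x0; rewrite subre_ge0// nexp_le1. Qed.

Lemma offspring_weight_ge0 c t p : cost_fun c -> 0 <= offspring_weight c t p.
Proof.
by move=> [_ c0]; rewrite /offspring_weight; case: ifPn => // _; exact: sub1_nexp_ge0.
Qed.

Lemma measurable_offspring_weight c d (T : measurableType d)
    (t : T -> R) (p : T -> R * R) : cost_fun c ->
  measurable_fun setT t -> measurable_fun setT p ->
  measurable_fun setT (fun x => offspring_weight c (t x) (p x)).
Proof.
move=> [mc _] mt mp.
have mp1 : measurable_fun setT (fun t => (p t).1) by exact: measurableT_comp.
have mp2 : measurable_fun setT (fun t => (p t).2) by exact: measurableT_comp.
apply: measurable_fun_ifT => //; first exact: measurable_fun_ler.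
apply: emeasurable_funB => //; apply: measurable_nexp.
apply: (measurableT_comp mc); apply: measurable_fun_pair => //.
exact: measurable_funB.
Qed.

Lemma offspring_rate_ge0 c b y t : cost_fun c -> 0 <= offspring_rate c b y t.
Proof.
move=> cc; apply: integral_ge0 => p _.
by rewrite mule_ge0 ?offspring_weight_ge0// lee_fin offspring_density_ge0.
Qed.

Lemma measurable_offspring_rate c d (T : measurableType d)
    (b : T -> OmegaB) (y t : T -> R) : cost_fun c ->
  measurable_fun setT b -> measurable_fun setT y -> measurable_fun setT t ->
  measurable_fun setT (fun x => offspring_rate c (b x) (y x) (t x)).
Proof.
move=> cc mb my mt.
apply: (@measurable_planar_integral R _ T
  (fun x p => offspring_weight c (t x) p * (offspring_density (b x) (y x) p)%:E)).
  apply: emeasurable_funM.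
    by apply: measurable_offspring_weight => //; exact: measurableT_comp.
  apply/measurable_EFinP; apply: measurable_offspring_density => //.
  - exact: measurableT_comp.
  - exact: measurableT_comp.
by move=> x p; rewrite mule_ge0 ?offspring_weight_ge0// lee_fin offspring_density_ge0.
Qed.

Lemma unit_fun_offspring_laplace c : cost_fun c -> unit_fun (offspring_laplace c).
Proof.
move=> cc; split.
  apply: (@measurable_ge0_integral _ _ _ _ _ PB
    (fun q b => nexp (offspring_rate c b q.1 q.2))).
    apply: measurable_nexp; apply: measurable_offspring_rate => //.
    - exact: measurableT_comp.
    - exact: measurableT_comp.
  by move=> *; exact: nexp_ge0.
move=> q; apply: unit_fun_integral01; apply: unit_fun_nexp.
  by apply: measurable_offspring_rate.
by move=> b; exact: offspring_rate_ge0.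
Qed.

(** The weight asks for a delay at most [t], and the density vanishes at negative delays. This is
    why events born after the horizon can be charged 0. *)
Lemma offspring_rate_lt0 c b y t : (t < 0)%R -> offspring_rate c b y t = 0.
Proof.
move=> t0; apply: integral0_eq => p _.
rewrite /offspring_weight; case: ifPn => [pt|_]; last by rewrite mul0e.
rewrite /offspring_density /patch [X in (_ * X)%R]ifF ?mulr0 ?mule0//.
by apply/negP => /set_mem; rewrite /= in_itv/= andbT leNgt (le_lt_trans pt t0).
Qed.

Lemma cost_fun_sub1_nexp (g : R * R -> \bar R) : cost_fun g ->
  cost_fun (fun p => 1 - nexp (g p)).
Proof.
move=> [mg g0]; split; last by move=> p; exact: sub1_nexp_ge0.
by apply: emeasurable_funB => //; exact: measurable_nexp.
Qed.

(** Converts a position (time, location) into the argument (location, time left) of a cost. *)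
Definition horizon_cost (c : R * R -> \bar R) (u : R) (p : R * R) : \bar R :=
  if (p.1 <= u)%R then c (p.2, u - p.1)%R else 0.

Lemma cost_fun_horizon c u : cost_fun c -> cost_fun (horizon_cost c u).
Proof.
move=> [mc c0]; split; last by move=> p; rewrite /horizon_cost; case: ifP.
apply: measurable_fun_ifT => //; first exact: measurable_fun_ler.
have m1 : measurable_fun setT (fun p : R * R => (p.2, u - p.1)%R).
  by apply: measurable_fun_pair => //; exact: measurable_funB.
exact: (measurableT_comp mc m1).
Qed.

(** A Laplace value 0 becomes the cost +oo, so passing to costs loses no information. *)
Definition offspring_cost (c : R * R -> \bar R) (q : R * R) : \bar R :=
  - lne (offspring_laplace c q).

Lemma cost_fun_offspring_cost c : cost_fun c -> cost_fun (offspring_cost c).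
Proof.
move=> cc; have [mo o01] := unit_fun_offspring_laplace cc.
split; first exact: measurable_nlne.
by move=> q; apply: nlne_ge0; case/andP: (o01 q).
Qed.

Lemma nexp_offspring_cost c q : cost_fun c ->
  nexp (offspring_cost c q) = offspring_laplace c q.
Proof.
move=> cc; apply: nexp_lne.
exact: (unit_fun_ge0 _ (unit_fun_offspring_laplace cc)).
Qed.

Lemma le_offspring_weight (c c' : R * R -> \bar R) t p :
  (forall q, c q <= c' q) -> offspring_weight c t p <= offspring_weight c' t p.
Proof.
by move=> cc'; rewrite /offspring_weight; case: ifP => // _; rewrite leeB// le_nexp.
Qed.

Lemma measurable_rate_integrand c b y t : cost_fun c ->
  measurable_fun setT (fun p => offspring_weight c t p *
    (offspring_density b y p)%:E).
Proof.
move=> cc; apply: emeasurable_funM.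
  exact: (measurable_offspring_weight cc).
by apply/measurable_EFinP; exact: measurable_offspring_density.
Qed.

Lemma rate_integrand_ge0 c b y t p : cost_fun c ->
  0 <= offspring_weight c t p * (offspring_density b y p)%:E.
Proof.
move=> cc; rewrite mule_ge0 ?offspring_weight_ge0// lee_fin.
exact: offspring_density_ge0.
Qed.

Lemma le_offspring_laplace (c c' : R * R -> \bar R) q :
  cost_fun c -> cost_fun c' -> (forall q, c q <= c' q) ->
  offspring_laplace c' q <= offspring_laplace c q.
Proof.
move=> cc cc' le_cc'.
have mr c0 : cost_fun c0 ->
    measurable_fun setT (fun b => nexp (offspring_rate c0 b q.1 q.2)).
  by move=> ?; apply: measurable_nexp; exact: measurable_offspring_rate.
apply: ge0_le_integral; [exact: measurableT|by move=> *; exact: nexp_ge0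
  |exact: mr|exact: mr|].
move=> b _; rewrite le_nexp; apply: ge0_le_integral => //.
- by move=> p _; exact: rate_integrand_ge0.
- exact: measurable_rate_integrand.
- exact: measurable_rate_integrand.
- move=> p _; apply: lee_wpmul2r; last exact: le_offspring_weight.
  by rewrite lee_fin; exact: offspring_density_ge0.
Qed.

(** * Iterates of the operator and their limit *)

Section fixed_point.
Context (f : R -> R).
Hypothesis f_bounded : bounded_measurable_nonneg f.

Local Notation J0 := ((fun q : OmegaJ * R => J q.1 q.2) \_ (setT `*` I)).
Local Notation f0 := (f \_ I).

(** This is [gamma] as a mean over the lifetime, written with extensions by zero so as to be
    measurable in (location, time left). *)
Definition life_laplace (q : R * R) : \bar R :=
  \int[PJ]_e nexp (if (q.2 < J0 (e, q.1))%R then (f0 q.1)%:E else 0).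

Let mf0 : measurable_fun setT f0.
Proof.
apply/(measurable_restrictT _ _).1; first exact: measurable_itv.
by case: f_bounded.
Qed.

Let f0_ge0 y : (0 <= f0 y)%R.
Proof.
rewrite /patch; case: ifPn => // /set_mem Iy.
by have [_ [M /(_ _ Iy)/andP[]]] := f_bounded.
Qed.

Let mJ0 : measurable_fun setT J0.
Proof.
apply/(measurable_restrictT _ _).1; last exact: (J_measurable params).
by apply: measurableX => //; exact: measurable_itv.
Qed.

Lemma unit_fun_life_laplace : unit_fun life_laplace.
Proof.
have uF : unit_fun (fun z : (R * R) * OmegaJ =>
    nexp (if (z.1.2 < J0 (z.2, z.1.1))%R then (f0 z.1.1)%:E else 0)).
  have m11 : measurable_fun setT (fun z : (R * R) * OmegaJ => z.1.1).
    exact: measurableT_comp.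
  have m12 : measurable_fun setT (fun z : (R * R) * OmegaJ => z.1.2).
    exact: measurableT_comp.
  apply: unit_fun_nexp; last by move=> z; case: ifP => // _; rewrite lee_fin.
  apply: measurable_fun_ifT => //.
    apply: measurable_fun_ltr => //.
    have m1 : measurable_fun setT (fun z : (R * R) * OmegaJ => (z.2, z.1.1)).
      exact: measurable_fun_pair.
    exact: (measurableT_comp mJ0 m1).
  by apply/measurable_EFinP; exact: (measurableT_comp mf0 m11).
have [mF F01] := uF; split.
  apply: (@measurable_ge0_integral R _ _ (R * R)%type _ PJ (fun q e =>
    nexp (if (q.2 < J0 (e, q.1))%R then (f0 q.1)%:E else 0))) => //.
  by move=> q e; exact: nexp_ge0.
move=> q; apply: unit_fun_integral01; split; last by move=> e; exact: (F01 (q, e)).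
exact: (measurableT_comp mF (pair1_measurable q)).
Qed.

Definition life_cost (q : R * R) : \bar R := - lne (life_laplace q).

Lemma cost_fun_life_cost : cost_fun life_cost.
Proof.
have [mo o01] := unit_fun_life_laplace.
split; first exact: measurable_nlne.
by move=> q; apply: nlne_ge0; case/andP: (o01 q).
Qed.

Lemma nexp_life_cost q : nexp (life_cost q) = life_laplace q.
Proof. apply: nexp_lne; exact: (unit_fun_ge0 _ unit_fun_life_laplace). Qed.

Lemma gamma_life_laplace y t : I y -> gamma PJ J y f t = life_laplace (y, t).
Proof.
move=> Iy; rewrite /gamma /survival /life_laplace/=.
have J0E e : J0 (e, y) = J e y by rewrite /patch mem_set.
have f0E : f0 y = f y by rewrite /patch mem_set.
pose D := [set e | (t < J e y)%R].
have mD : measurable D.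
  rewrite (_ : D = (fun e => t < J0 (e, y))%R @^-1` [set true]); last first.
    by apply/seteqP; split => e; rewrite /D/= J0E.
  rewrite -[X in measurable X]setTI.
  have : measurable_fun setT (fun e => t < J0 (e, y))%R.
    apply: measurable_fun_ltr => //; exact: (measurableT_comp mJ0 (pair2_measurable y)).
  by apply.
have PD1 : PJ D \is a fin_num by exact: fin_num_measure.
rewrite -/D; transitivity (\int[PJ]_e ((\1_(~` D) e)%:E + (\1_D e)%:E * (expR (- f y))%:E)).
  have i1 : measurable_fun setT (fun e => (\1_D e)%:E : \bar R).
    by apply/measurable_EFinP; exact: measurable_indic.
  have i2 : measurable_fun setT (fun e => (\1_(~` D) e)%:E : \bar R).
    by apply/measurable_EFinP; apply: measurable_indic; exact: measurableC.
  have i3 : measurable_fun setT (fun e => (\1_D e)%:E * (expR (- f y))%:E).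
    exact: emeasurable_funM.
  have i4 e : 0 <= (\1_D e)%:E * (expR (- f y))%:E.
    by rewrite mule_ge0 ?lee_fin ?expR_ge0.
  rewrite ge0_integralD// ge0_integralZr ?lee_fin ?expR_ge0//.
  rewrite integral_indic ?setIT//; last exact: measurableC.
  congr (_ + _); first exact/esym/probability_setC.
  by rewrite integral_indic ?setIT.
apply: eq_integral => e _; rewrite J0E f0E !indicE in_setC.
have -> : (e \in D) = (t < J e y)%R by apply/idP/idP => [/set_mem|/mem_set].
by case: ifP => _ /=; rewrite ?mul1e ?mul0e ?adde0 ?add0e// nexp0.
Qed.

Definition next_cost (c : R * R -> \bar R) (q : R * R) : \bar R :=
  life_cost q + offspring_cost c q.

Lemma cost_fun_next_cost c : cost_fun c -> cost_fun (next_cost c).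
Proof.
move=> cc; have [m1 c1] := cost_fun_life_cost; have [m2 c2] := cost_fun_offspring_cost cc.
by split=> [|q]; [exact: emeasurable_funD|rewrite adde_ge0].
Qed.

Lemma le_next_cost (c c' : R * R -> \bar R) : cost_fun c -> cost_fun c' ->
  (forall q, c q <= c' q) -> forall q, next_cost c q <= next_cost c' q.
Proof.
move=> cc cc' le_cc' q; rewrite /next_cost; apply: leeD; first exact: lexx.
have := le_offspring_laplace q cc cc' le_cc'.
by rewrite -(nexp_offspring_cost q cc) -(nexp_offspring_cost q cc') le_nexp.
Qed.

Definition iterated_cost n : R * R -> \bar R := iter n next_cost life_cost.

Lemma cost_fun_iterated_cost n : cost_fun (iterated_cost n).
Proof.
elim: n => [|n ih]; first exact: cost_fun_life_cost.
exact: cost_fun_next_cost.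
Qed.

(** The first step increases because offspring only add cost; monotonicity of [next_cost] propagates
    this. *)
Lemma nondecreasing_iterated_cost q : nondecreasing_seq (fun n => iterated_cost n q).
Proof.
apply/nondecreasing_seqP => n; elim: n q => [|n ih] q.
  rewrite leeDl//.
  by have [_ ] := cost_fun_offspring_cost (cost_fun_iterated_cost 0).
exact: (le_next_cost (cost_fun_iterated_cost n) (cost_fun_iterated_cost n.+1) ih q).
Qed.

Definition limit_cost q : \bar R := limn (fun n => iterated_cost n q).

Lemma iterated_cost_cvg q : iterated_cost n q @[n --> \oo] --> limit_cost q.
Proof. exact: (ereal_nondecreasing_is_cvgn (nondecreasing_iterated_cost q)). Qed.

Lemma cost_fun_limit_cost : cost_fun limit_cost.
Proof.
split.
  apply: (emeasurable_fun_cvg iterated_cost) => [n|q _]; last exact: iterated_cost_cvg.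
  by case: (cost_fun_iterated_cost n).
move=> q; apply: lime_ge.
  by apply/cvg_ex; exists (limit_cost q); exact: iterated_cost_cvg.
by apply: nearW => n; case: (cost_fun_iterated_cost n).
Qed.

Lemma offspring_weight_cvg t p :
  offspring_weight (iterated_cost n) t p @[n --> \oo] --> offspring_weight limit_cost t p.
Proof.
rewrite /offspring_weight; case: ifP => _; last exact: cvg_cst.
apply: cvgeB => //; first exact: cvg_cst.
apply: nexp_cvg; last exact: iterated_cost_cvg.
  by move=> n; case: (cost_fun_iterated_cost n).
by case: cost_fun_limit_cost.
Qed.

(** Rates may be infinite, hence monotone convergence inside the exponential; the mean over marks is
    bounded by 1, hence dominated convergence outside. *)
Lemma offspring_laplace_cvg q :
  offspring_laplace (iterated_cost n) q @[n --> \oo] --> offspring_laplace limit_cost q.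
Proof.
have ur c : cost_fun c -> unit_fun (fun b => nexp (offspring_rate c b q.1 q.2)).
  move=> cc; apply: unit_fun_nexp; first exact: measurable_offspring_rate.
  by move=> b; exact: offspring_rate_ge0.
have un n := ur _ (cost_fun_iterated_cost n).
apply: (@dominated_cvg _ _ _ PB setT measurableT _ _ (cst 1)) => //.
- by move=> n; case: (un n).
- move=> b _; apply: nexp_cvg.
  + by move=> n; apply: offspring_rate_ge0; exact: cost_fun_iterated_cost.
  + by apply: offspring_rate_ge0; exact: cost_fun_limit_cost.
  + apply: integral_monotone_cvg.
    * move=> n; exact: (measurable_rate_integrand _ _ _ (cost_fun_iterated_cost n)).
    * by move=> n p; apply: rate_integrand_ge0; exact: cost_fun_iterated_cost.
    * move=> p m n mn; apply: lee_wpmul2r.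
        by rewrite lee_fin; exact: offspring_density_ge0.
      by apply: le_offspring_weight => q'; exact: nondecreasing_iterated_cost.
    * by move=> p; apply: cvgeZr => //; exact: offspring_weight_cvg.
- exact: finite_measure_integrable_cst.
- by move=> n b _; rewrite gee0_abs ?(unit_fun_ge0 _ (un n))// (unit_fun_le1 _ (un n)).
Qed.

(** The shifted sequence of iterates has two limits: one by convergence of the costs, one by
    continuity of the recursion. *)
Lemma nexp_limit_cost q :
  nexp (limit_cost q) = life_laplace q * offspring_laplace limit_cost q.
Proof.
have h1 : nexp (iterated_cost n.+1 q) @[n --> \oo] --> nexp (limit_cost q).
  apply: nexp_cvg.
  - by move=> n; case: (cost_fun_iterated_cost n.+1).
  - by case: cost_fun_limit_cost.
  - by rewrite (cvg_shiftS (fun n => iterated_cost n q)); exact: iterated_cost_cvg.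
have h2 : nexp (iterated_cost n.+1 q) @[n --> \oo] -->
    life_laplace q * offspring_laplace limit_cost q.
  rewrite (_ : (fun n => _) =
    (fun n => life_laplace q * offspring_laplace (iterated_cost n) q)).
    apply: cvgeZl; last exact: offspring_laplace_cvg.
    exact: (unit_fun_fin _ unit_fun_life_laplace).
  apply/funext => n; rewrite /= /next_cost nexpD.
  - rewrite nexp_life_cost// nexp_offspring_cost//.
    exact: cost_fun_iterated_cost.
  - by case: cost_fun_life_cost.
  - by case: (cost_fun_offspring_cost (cost_fun_iterated_cost n)).
exact: (cvg_unique _ h1 h2).
Qed.

(** The delay s stays in [0, u], so [xi] is evaluated at nonnegative times only and has to be known
    only there and for locations in [0, 1]. *)
Lemma beta_offspring_laplace (c : R * R -> \bar R)
    (xi : R -> (R -> R) -> R -> \bar R) x u :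
  cost_fun c -> I x ->
  (forall y t, I y -> (0 <= t)%R -> xi y f t = nexp (c (y, t))) ->
  beta PB B x (fun y => \int[leb]_(s in `[0%R, u])
    ((1 - xi y f (u - s)%R) * (W y x * h s)%:E)) = offspring_laplace c (x, u).
Proof.
move=> cc Ix xiE; apply: eq_integral => b _; congr (expeR (- _)) => /=.
have mint := measurable_rate_integrand b x u cc.
rewrite /offspring_rate integral_planar//; last by move=> p; exact: rate_integrand_ge0.
(* [beta] integrates over the location outside and over the delay inside, the reverse of the planar
   order. *)
have -> : \int[leb]_s \int[leb]_z (offspring_weight c u (s, z) *
      (offspring_density b x (s, z))%:E) =
    \int[leb]_z \int[leb]_s (offspring_weight c u (s, z) *
      (offspring_density b x (s, z))%:E).
  apply: (@fubini_tonelli _ _ _ _ R leb leb (fun p => offspring_weight c u p *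
      (offspring_density b x p)%:E)) => //.
  by move=> p; exact: rate_integrand_ge0.
rewrite integral_mkcond; apply: eq_integral => z _; rewrite patchE.
case: ifPn => [/set_mem Iz|zI]; last first.
  rewrite integral0_eq// => s _; rewrite offspring_densityE// ifF ?mule0//.
  by apply/negP => /set_mem[_ /= zI']; move: zI; rewrite mem_set.
pose h0 := h \_ `[0%R, +oo[.
pose G s := offspring_weight c u (s, z) * (W z x * h0 s)%:E.
have mh0 : measurable_fun setT h0.
  apply/(measurable_restrictT _ _).1 => //.
  by have /integrableP[/measurable_EFinP] := h_L1 params.
have h0_ge0 s : (0 <= h0 s)%R.
  rewrite /h0 /patch; case: ifPn => // /set_mem; rewrite /= in_itv/= andbT.
  exact: (h_ge0 params).
have W_ge0 : (0 <= W z x)%R by exact: (W_ge0 params).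
have B_ge0 : (0 <= B b z x)%R by exact: (B_ge0 params).
have G_ge0 s : 0 <= G s.
  by rewrite /G mule_ge0 ?offspring_weight_ge0 ?lee_fin ?mulr_ge0.
have mG : measurable_fun setT G.
  apply: emeasurable_funM.
    exact: (measurable_offspring_weight cc (measurable_cst u) (pair2_measurable z)).
  by apply/measurable_EFinP; exact: measurable_funM.
transitivity ((\int[leb]_s G s) * (B b z x)%:E).
  congr (_ * _); rewrite integral_mkcond; apply: eq_integral => s _.
  rewrite patchE /G /offspring_weight /h0 /patch/=.
  case: ifPn => [/set_mem/=|su]; rewrite ?in_itv/=.
    move=> /andP[s0 su]; rewrite su mem_set ?xiE ?subr_ge0//.
    by rewrite /= in_itv/= s0.
  (* Outside [0, u], either s > u and the weight vanishes, or s < 0 and [h0] does. *)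
  case: ifPn => [su'|_]; last by rewrite mul0e.
  rewrite ifF ?mulr0 ?mule0//; apply/negP => /set_mem; rewrite /= in_itv/= andbT => s0.
  by move: su; rewrite mem_set//= in_itv/= s0.
rewrite -ge0_integralZr//.
apply: eq_integral => s _; rewrite /G -muleA -EFinM; congr (_ * _%:E).
rewrite offspring_densityE// in_setX (mem_set (Iz : I (s, z).2)) andbT /h0 /patch/=.
by case: ifP => _; rewrite ?mulr0 ?mul0r// mulrC mulrA.
Qed.

(** * Conditional laws in the event tree *)

Section cluster_process.
Context d (Omega : measurableType d) (P : probability Omega R)
  (S : event_tree OmegaB Omega) (x : R)
  (S_cluster : is_cluster PB PJ h W B J P S x).

Definition history_generators (V U : set (seq nat)) : set (set Omega) :=
  [set E | [\/ exists2 v, V v & E = [set w | born S v w],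
               exists v (A : set (R * R)),
                 [/\ V v, measurable A & E = pos S v @^-1` A] |
               exists v (A : set OmegaB),
                 [/\ U v, measurable A & E = mark S v @^-1` A]]].

(* A sub-sigma-algebra seen as a measurable type of its own: conditioning on it
   is conditioning on the identity map into this type. *)
Definition history_space V U := g_sigma_algebraType (history_generators V U).

Lemma history_generators_measurable V U : history_generators V U `<=` measurable.
Proof.
have pre d' (T : measurableType d') (Y : Omega -> T) A :
    measurable_fun setT Y -> measurable A -> measurable (Y @^-1` A).
  by move=> mf mA; rewrite -[X in measurable X]setTI; exact: mf.
move=> E [[v _ ->]|[v [A [_ mA ->]]]|[v [A [_ mA ->]]]].
- rewrite (_ : [set w | born S v w] = born S v @^-1` [set true])//.
  by apply: pre => //; exact: (born_measurable S_cluster).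
- by apply: pre => //; exact: (pos_measurable S_cluster).
- by apply: pre => //; exact: (mark_measurable S_cluster).
Qed.

Lemma measurable_to_history V U :
  measurable_fun setT (id : Omega -> history_space V U).
Proof.
move=> _ A mA; rewrite setTI preimage_id.
exact: (smallest_sub (@sigma_algebra_measurable _ Omega)
  (@history_generators_measurable V U) mA).
Qed.

Lemma history_measurable_born V U v : V v ->
  measurable_fun setT (born S v : history_space V U -> bool).
Proof.
move=> Vv; apply: (measurable_fun_bool true); rewrite setTI.
by apply: sub_sigma_algebra; constructor 1; exists v.
Qed.

Lemma history_measurable_pos V U v : V v ->
  measurable_fun setT (pos S v : history_space V U -> R * R).
Proof.
move=> Vv _ A mA; rewrite setTI.
by apply: sub_sigma_algebra; constructor 2; exists v, A.
Qed.

Lemma location_in_I v w : I (location S v w).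
Proof. exact: (location_in S_cluster). Qed.

Definition event_density (v : seq nat) (w : Omega) (p : R * R) : R :=
  if born S v w then
    offspring_density (mark S v w) (location S v w)
      (p.1 - birth S v w, p.2)%R
  else 0%R.

Lemma event_density_ge0 v w p : (0 <= event_density v w p)%R.
Proof.
by rewrite /event_density; case: ifP => // _; exact: offspring_density_ge0.
Qed.

Lemma measurable_birth v : measurable_fun setT (birth S v).
Proof. exact: (measurableT_comp measurable_fst (pos_measurable S_cluster v)). Qed.

Lemma measurable_location v : measurable_fun setT (location S v).
Proof. exact: (measurableT_comp measurable_snd (pos_measurable S_cluster v)). Qed.

Lemma measurable_event_density v :
  measurable_fun setT (fun z : Omega * (R * R) => event_density v z.1 z.2).
Proof.
apply: measurable_fun_ifT => //.
  exact: (measurableT_comp (born_measurable S_cluster v)).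
apply: measurable_offspring_density.
- exact: (measurableT_comp (mark_measurable S_cluster v)).
- exact: (measurableT_comp (measurable_location v)).
- apply: measurable_fun_pair.
    apply: measurable_funB.
      exact: measurableT_comp.
    exact: (measurableT_comp (measurable_birth v)).
  exact: measurableT_comp.
Qed.

(** The restriction to times after the birth and to locations in [0, 1] is absorbed by the zero
    extensions in the density. *)
Lemma intensityE v w A :
  intensity h W B S v w A =
  \int[leb \x leb]_p ((\1_A p)%:E * (event_density v w p)%:E).
Proof.
rewrite /intensity; case: ifPn => bv; last first.
  rewrite integral0_eq// => p _.
  by rewrite /event_density (negbTE bv) mule0.
rewrite integral_mkcond; apply: eq_integral => p _.
rewrite /patch /event_density bv indicE offspring_densityE; last exact: location_in_I.
rewrite in_setI; case: (p \in A); rewrite /= ?mul0e// mul1e.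
rewrite (fun_if EFin); congr (if _ then _ else _).
apply/idP/idP => /set_mem/= [h1 h2]; apply/mem_set; split => //=.
  by move: h1; rewrite /= !in_itv/= !andbT subr_ge0.
by move: h1; rewrite /= !in_itv/= !andbT subr_ge0.
Qed.

Definition event_rate (g : R * R -> \bar R) (v : seq nat) (w : Omega) : \bar R :=
  \int[leb \x leb]_p (g p * (event_density v w p)%:E).

Lemma event_rate_ge0 g v w : (forall p, 0 <= g p) -> 0 <= event_rate g v w.
Proof.
move=> g0; apply: integral_ge0 => p _; rewrite mule_ge0// lee_fin.
exact: event_density_ge0.
Qed.

Lemma measurable_event_rate g v : cost_fun g -> measurable_fun setT (event_rate g v).
Proof.
move=> [mg g0]; apply: (@measurable_planar_integral R _ Omega
  (fun w p => g p * (event_density v w p)%:E)).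
  apply: emeasurable_funM; first exact: (measurableT_comp mg).
  by apply/measurable_EFinP; exact: measurable_event_density.
by move=> w p; rewrite mule_ge0// lee_fin event_density_ge0.
Qed.

Definition child_cost (g : R * R -> \bar R) (v : seq nat) (w : Omega) (i : nat) : \bar R :=
  if born S (rcons v i) w then g (pos S (rcons v i) w) else 0.

Lemma child_cost_ge0 g v w i : (forall p, 0 <= g p) -> 0 <= child_cost g v w i.
Proof. by move=> g0; rewrite /child_cost; case: ifP. Qed.

Lemma measurable_child_cost g v i : measurable_fun setT g ->
  measurable_fun setT (child_cost g v ^~ i).
Proof.
move=> mg; apply: measurable_fun_ifT => //; first exact: (born_measurable S_cluster).
exact: (measurableT_comp mg (pos_measurable S_cluster _)).
Qed.

Lemma offspringE v w A : offspring S v w A =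
  \sum_(i <oo) child_cost (fun p => (\1_A p)%:E) v w i.
Proof.
rewrite /offspring counting_dirac; apply: eq_eseriesr => i _.
rewrite diracE /child_cost indicE; case: ifPn => bi.
  congr (_%:R%:E); congr nat_of_bool.
  by apply/idP/idP => /set_mem h1; apply/mem_set => //; case: h1.
by rewrite memNset// => -[] /= bi'; rewrite bi' in bi.
Qed.

Lemma nat_or_infinite_offspring v w A : nat_or_infinite (offspring S v w A).
Proof.
by rewrite /offspring /counting; case: ifPn => _; [right; eexists|left].
Qed.

Lemma measurable_offspring v A : measurable A ->
  measurable_fun setT (fun w => offspring S v w A).
Proof.
move=> mA; under eq_fun do rewrite offspringE.
apply: ge0_emeasurable_sum => [i w _ _|i _].
  by apply: child_cost_ge0 => p; rewrite lee_fin.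
by apply: measurable_child_cost; apply/measurable_EFinP; exact: measurable_indic.
Qed.

Lemma measurable_level_set (g : {nnsfun (R * R) >-> R}) r : measurable (g @^-1` [set r]).
Proof. by []. Qed.

(** Level sets of [g] provide the disjoint sets required by [offspring_poisson]; the pairs in [sJ]
    are indexed by ordinals to match it. *)
Lemma offspring_counts_poisson n (sJ : seq (seq nat * R)) (g : {nnsfun (R * R) >-> R})
    (k : seq nat * R -> nat) :
  uniq sJ -> (forall j, j \in sJ -> size j.1 = n) ->
  cond_eq P (id : Omega -> history_space (size_le n) (size_le n))
    (fun w => \prod_(j <- sJ) (\1_((fun w => offspring S j.1 w (g @^-1` [set j.2]))
       @^-1` [set (k j)%:R%:E]) w)%:E)
    (fun w => \prod_(j <- sJ)
       poisson_mass (intensity h W B S j.1 w (g @^-1` [set j.2])) (k j)).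
Proof.
move=> us sJn G mG.
pose t := in_tuple sJ.
have tin (i : 'I_(size sJ)) : tnth t i \in sJ by exact: mem_tnth.
(* A point common to two level sets forces equal values; with equal events the two pairs coincide,
   against [uniq]. *)
have disj : forall i j : 'I_(size sJ), i != j -> (tnth t i).1 = (tnth t j).1 ->
    g @^-1` [set (tnth t i).2] `&` g @^-1` [set (tnth t j).2] = set0.
  move=> i j ij e1; apply/seteqP; split => // p [/= e2 e3].
  move: ij; apply/negP; rewrite negbK; apply/eqP.
  have /tuple_uniqP tinj : uniq t by [].
  apply: tinj.
  by rewrite (surjective_pairing (tnth t i)) (surjective_pairing (tnth t j)) e1 -e2 -e3.
have h1 := offspring_poisson S_cluster
  (v := fun i => (tnth t i).1) (A := fun i => g @^-1` [set (tnth t i).2])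
  (fun i => k (tnth t i)) (fun i => sJn _ (tin i))
  (fun i => measurable_level_set g _) disj mG.
under [RHS]eq_integral do rewrite big_tnth.
rewrite preimage_id -[RHS]h1 setI_integral_prod//.
- congr (P (_ `&` _)); apply/seteqP; split => [w Dw i|w Dw j js]/=.
    exact: Dw (tnth t i) (tin i).
  have [i ->] : exists i, j = tnth t i by apply/tnthP.
  exact: Dw.
- by have := @measurable_to_history (size_le n) (size_le n) measurableT G mG; rewrite setTI.
- move=> j _; rewrite -[X in measurable X]setTI.
  by apply: measurable_offspring => //; exact: emeasurable_set1.
Qed.

Local Notation generation_history n :=
  (id : Omega -> history_space (size_le n) (size_le n)).

Lemma nexp_sub1 (r : R) : (1 - expR (- r))%:E = 1 - nexp r%:E.
Proof. by []. Qed.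

(** For a simple cost, the children of [v] cost the sum over values r of r times the number of
    children in the level set of r, and these counts are independent Poisson. *)
Lemma cond_eq_offspring_simple n (s : seq (seq nat)) (g : {nnsfun (R * R) >-> R}) :
  uniq s -> (forall v, v \in s -> size v = n) ->
  cond_eq P (generation_history n)
    (fun w => \prod_(v <- s) nexp (\sum_(i <oo) child_cost (EFin \o g) v w i))
    (fun w => \prod_(v <- s) nexp (event_rate (fun p => 1 - nexp (g p)%:E) v w)).
Proof.
move=> us sn.
pose sJ := [seq (v, r) | v <- s, r <- positive_values g].
have usJ : uniq sJ.
  apply: allpairs_uniq => //; first exact: positive_values_uniq.
  by move=> -[? ?] [? ?] _ _ [-> ->].
have mind r : measurable_fun setT (fun p => (\1_(g @^-1` [set r]) p)%:E : \bar R).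
  by apply/measurable_EFinP; exact: measurable_indic.
have sJn j : j \in sJ -> size j.1 = n by move=> /allpairsP[[v r]/= [/sn vn _ ->]].
have sJ0 j : j \in sJ -> (0 < j.2)%R.
  by move=> /allpairsP[[v r]/= [_ r0 ->]]; exact: positive_values_gt0 r0.
have mint j : measurable_fun setT
    (fun w => intensity h W B S j.1 w (g @^-1` [set j.2])).
  under eq_fun do rewrite intensityE.
  by apply: measurable_event_rate; split=> // p; rewrite lee_fin.
have int0 j w : 0 <= intensity h W B S j.1 w (g @^-1` [set j.2]).
  rewrite intensityE.
  by apply: event_rate_ge0 => p; rewrite lee_fin.
have := cond_eq_poisson (P := P) (X := generation_history n)
  (measurable_to_history (V := size_le n) (U := size_le n))
  (s := sJ) (N := fun j w => offspring S j.1 w (g @^-1` [set j.2]))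
  (m := fun j w => intensity h W B S j.1 w (g @^-1` [set j.2]))
  (a := snd) usJ
  (fun j => measurable_offspring j.1 (measurable_level_set g j.2))
  (fun j w => nat_or_infinite_offspring j.1 w _)
  mint int0 sJ0 (fun k => offspring_counts_poisson g k usJ sJn).
apply: eq_cond_eq => w.
- rewrite big_allpairs/=; apply: eq_bigr => v _.
  rewrite -nexp_sum; last first.
    by move=> r /positive_values_gt0 r0; rewrite mule_ge0 ?lee_fin ?(ltW r0).
  congr nexp.
  transitivity (\sum_(r <- positive_values g | r \in positive_values g)
      \sum_(i <oo) (r%:E * child_cost (fun p => (\1_(g @^-1` [set r]) p)%:E) v w i)).
    rewrite big_seq; apply: eq_bigr => r _; rewrite offspringE nneseriesZl// => i _.
    by apply: child_cost_ge0 => p; rewrite lee_fin.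
  rewrite -nneseries_sum; last first.
    move=> r i /positive_values_gt0 r0; rewrite mule_ge0 ?lee_fin ?(ltW r0)//.
    by apply: child_cost_ge0 => p; rewrite lee_fin.
  apply: eq_eseriesr => i _; rewrite -big_seq.
  rewrite /child_cost; case: ifPn => bi; last by rewrite big1// => r _; rewrite mule0.
  by rewrite -(@nnsfun_comp_sum _ _ _ g EFin (pos S (rcons v i) w)).
- rewrite big_allpairs/=; apply: eq_bigr => v _.
  rewrite -nexp_sum; last first.
    move=> r /positive_values_gt0 r0; rewrite mule_ge0 ?(int0 (v, r))// lee_fin.
    by rewrite subr_ge0 -[leRHS]expR0 ler_expR oppr_le0 (ltW r0).
  congr nexp.
  (* 1 - exp(-r) is replaced by 0 off the positive reals, so that nonnegativity holds for every
     index, as exchanging sum and integral asks. *)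
  pose c r : R := if (0 < r)%R then (1 - expR (- r))%R else 0%R.
  have c0 r : (0 <= c r)%R.
    rewrite /c; case: ifPn => // r0.
    by rewrite subr_ge0 -[leRHS]expR0 ler_expR oppr_le0 (ltW r0).
  have cE r : r \in positive_values g -> c r = (1 - expR (- r))%R.
    by move=> /positive_values_gt0 r0; rewrite /c r0.
  have mdens r : measurable_fun setT (fun p : R * R =>
      (\1_(g @^-1` [set r]) p)%:E * (event_density v w p)%:E).
    apply: emeasurable_funM => //; apply/measurable_EFinP.
    exact: (measurableT_comp (measurable_event_density v)
      (pair1_measurable w)).
  rewrite /event_rate.
  transitivity (\int[leb \x leb]_p \sum_(r <- positive_values g)
     ((c r)%:E * ((\1_(g @^-1` [set r]) p)%:E * (event_density v w p)%:E))).
    rewrite ge0_integral_sum//; last 2 first.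
    + move=> r; apply: measurable_funeM; exact: (mdens r).
    + by move=> r p _; rewrite !mule_ge0 ?lee_fin ?event_density_ge0.
    rewrite big_seq [RHS]big_seq; apply: eq_bigr => r rg.
    rewrite -(cE _ rg) intensityE ge0_integralZl//.
    - exact: (mdens r).
    - by move=> p _; rewrite mule_ge0 ?lee_fin ?event_density_ge0.
    - by rewrite lee_fin.
  apply: eq_integral => p _.
  rewrite (@nnsfun_comp_sum _ _ _ g (fun r => 1 - nexp r%:E)); last first.
    by rewrite nexp0 subee.
  rewrite big_seq [in RHS]big_seq ge0_sume_distrl; last first.
    by move=> r rg; rewrite -nexp_sub1 -cE// mule_ge0 ?lee_fin.
  by apply: eq_bigr => r rg; rewrite muleA cE.
Qed.

Lemma measurable_children_cost g v : cost_fun g ->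
  measurable_fun setT (fun w => \sum_(i <oo) child_cost g v w i).
Proof.
move=> [mg g0]; apply: ge0_emeasurable_sum => [i w _ _|i _].
  exact: child_cost_ge0.
exact: measurable_child_cost.
Qed.

(** Simple functions increase to [g]; child costs and rates follow by monotone convergence, and the
    bounded products pass to the limit. *)
Lemma cond_eq_offspring n (s : seq (seq nat)) (g : R * R -> \bar R) :
  cost_fun g -> uniq s -> (forall v, v \in s -> size v = n) ->
  cond_eq P (generation_history n)
    (fun w => \prod_(v <- s) nexp (\sum_(i <oo) child_cost g v w i))
    (fun w => \prod_(v <- s) nexp (event_rate (fun p => 1 - nexp (g p)) v w)).
Proof.
move=> cg us sn G mG; have [mg g0] := cg.
pose gn := nnsfun_approx measurableT mg.
have mG' : measurable ((generation_history n) @^-1` G).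
  by have := @measurable_to_history (size_le n) (size_le n) measurableT G mG;
    rewrite setTI.
have cgn k : cost_fun (EFin \o gn k).
  split; last by move=> p; rewrite lee_fin.
  exact/measurable_EFinP.
have gn_cvg p : (gn k p)%:E @[k --> \oo] --> g p by exact: cvg_nnsfun_approx.
have gn_nd p : nondecreasing_seq (fun k => (gn k p)%:E).
  by move=> k l kl; rewrite lee_fin; exact/lefP/nd_nnsfun_approx.
have lhs : \int[P]_(w in (generation_history n) @^-1` G)
      (\prod_(v <- s) nexp (\sum_(i <oo) child_cost (EFin \o gn k) v w i)) @[k --> \oo] -->
    \int[P]_(w in (generation_history n) @^-1` G)
      (\prod_(v <- s) nexp (\sum_(i <oo) child_cost g v w i)).
  apply: (@cvg_integral_prod_nexp _ _ _ P _ _ s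
    (fun k v w => \sum_(i <oo) child_cost (EFin \o gn k) v w i)
    (fun v w => \sum_(i <oo) child_cost g v w i)) => //.
  - by move=> k v; exact: measurable_children_cost.
  - move=> k v w; apply: nneseries_ge0 => i _ _.
    by apply: child_cost_ge0 => p; rewrite lee_fin.
  - by move=> v; exact: measurable_children_cost.
  - by move=> v w; apply: nneseries_ge0 => i _ _; exact: child_cost_ge0.
  - move=> v w; apply: nneseries_monotone_cvg.
    + by move=> k i; apply: child_cost_ge0 => p; rewrite lee_fin.
    + by move=> i k l kl; rewrite /child_cost; case: ifP => // _; exact: gn_nd.
    + by move=> i; rewrite /child_cost; case: ifP => // _; [exact: gn_cvg|exact: cvg_cst].
have rhs : \int[P]_(w in (generation_history n) @^-1` G)
      (\prod_(v <- s) nexp (event_rate (fun p => 1 - nexp (gn k p)%:E) v w)) @[k --> \oo] -->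
    \int[P]_(w in (generation_history n) @^-1` G)
      (\prod_(v <- s) nexp (event_rate (fun p => 1 - nexp (g p)) v w)).
  have c1 k := cost_fun_sub1_nexp (cgn k); have c2 := cost_fun_sub1_nexp cg.
  apply: (@cvg_integral_prod_nexp _ _ _ P _ _ s
    (fun k v w => event_rate (fun p => 1 - nexp (gn k p)%:E) v w)
    (fun v w => event_rate (fun p => 1 - nexp (g p)) v w)) => //.
  - by move=> k v; exact: (measurable_event_rate v (c1 k)).
  - by move=> k v w; apply: event_rate_ge0 => p; case: (c1 k) => _; exact.
  - by move=> v; exact: (measurable_event_rate v c2).
  - by move=> v w; apply: event_rate_ge0 => p; case: c2 => _; exact.
  - move=> v w; have mden : measurable_fun setT (fun p => (event_density v w p)%:E).
      apply/measurable_EFinP; exact: (measurableT_comp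
        (measurable_event_density v) (pair1_measurable w)).
    have d0 p : 0 <= (event_density v w p)%:E.
      by rewrite lee_fin; exact: event_density_ge0.
    apply: integral_monotone_cvg.
    + move=> k; have [m1 _] := c1 k.
      exact: emeasurable_funM m1 mden.
    + by move=> k p; rewrite mule_ge0//; case: (c1 k) => _; exact.
    + move=> p k l kl; rewrite lee_wpmul2r// leeB// le_nexp; exact: gn_nd.
    + move=> p; apply: cvgeZr => //.
      apply: cvgeB => //; first exact: cvg_cst.
      by apply: nexp_cvg => // k; rewrite lee_fin.
rewrite -(cvg_lim _ lhs)// -(cvg_lim _ rhs)//; congr (limn _); apply/funext => k.
exact: (cond_eq_offspring_simple (gn k) us sn).
Qed.

Definition event_cost (c : R * R -> \bar R) (u : R) (v : seq nat) (w : Omega) : \bar R :=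
  if born S v w then horizon_cost c u (pos S v w) else 0.

Lemma event_cost_ge0 c u v w : cost_fun c -> 0 <= event_cost c u v w.
Proof.
by move=> /(cost_fun_horizon u)[_ c0]; rewrite /event_cost; case: ifP.
Qed.

Lemma history_measurable_event_cost V U c u v : cost_fun c -> V v ->
  measurable_fun setT (event_cost c u v : history_space V U -> \bar R).
Proof.
move=> /(cost_fun_horizon u)[mc _] Vv.
apply: measurable_fun_ifT => //; first exact: (history_measurable_born (U := U) Vv).
have mp := history_measurable_pos (U := U) Vv.
exact: (@measurableT_comp _ _ _ _ _ _ _ _ _ mc mp).
Qed.

Lemma measurable_event_cost c u v : cost_fun c -> measurable_fun setT (event_cost c u v).
Proof.
move=> /(cost_fun_horizon u)[mc _].
apply: measurable_fun_ifT => //; first exact: (born_measurable S_cluster).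
exact: (measurableT_comp mc (pos_measurable S_cluster v)).
Qed.

(** Translating time by the birth of [v] turns the horizon [u] into the time left; past the horizon
    1 - exp(-0) = 0. *)
Lemma event_rate_horizon c u v w : cost_fun c ->
  event_rate (fun p => 1 - nexp (horizon_cost c u p)) v w =
  if born S v w then
    offspring_rate c (mark S v w) (location S v w) (u - birth S v w)%R
  else 0.
Proof.
move=> cc; rewrite /event_rate; case: ifPn => bv; last first.
  by rewrite integral0_eq// => p _; rewrite /event_density (negbTE bv) mule0.
rewrite /offspring_rate.
pose F p := offspring_weight c (u - birth S v w)%R p *
  (offspring_density (mark S v w) (location S v w) p)%:E.
rewrite -(planar_integral_translation (f := F) (birth S v w)).
- apply: eq_integral => p _; rewrite /F /event_density bv; congr (_ * _).
  rewrite /offspring_weight /horizon_cost/= lerD2r.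
  by case: ifP => // _; [congr (1 - nexp (c (_, _))); ring|rewrite nexp0 subee].
- apply: emeasurable_funM.
    exact: (measurable_offspring_weight cc).
  by apply/measurable_EFinP; exact: measurable_offspring_density.
- move=> p; rewrite mule_ge0//; first exact: offspring_weight_ge0.
  by rewrite lee_fin; exact: offspring_density_ge0.
Qed.

(** For an event born after the horizon the charge is 0 on the left, while on the right the rate
    vanishes for every mark, the time left being negative. *)
Lemma nexp_event_offspring_cost c u v w : cost_fun c ->
  nexp (event_cost (offspring_cost c) u v w) =
  \int[PB]_b nexp (if born S v w then
    offspring_rate c b (location S v w) (u - birth S v w)%R else 0).
Proof.
move=> cc; rewrite /event_cost; case: ifPn => bv; last first.
  rewrite nexp0 (eq_integral (cst 1))//.
  by rewrite integral_cst//= mul1e probability_setT.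
rewrite /horizon_cost; case: ifPn => [bu|].
  by rewrite nexp_offspring_cost.
rewrite -ltNge => ub; rewrite nexp0 (eq_integral (cst 1)); last first.
  by move=> b _; rewrite /= offspring_rate_lt0 ?nexp0// subr_lt0.
by rewrite integral_cst//= mul1e probability_setT.
Qed.

(** The conditioning contains the births of generation n but only the marks of earlier ones:
    locations and times left are frozen while the marks of generation n remain independent with law
    [PB]. *)
Lemma mark_laplace n (s : seq (seq nat)) c u :
  cost_fun c -> uniq s -> (forall v, v \in s -> size v = n) ->
  cond_eq P (id : Omega -> history_space (size_le n) (size_lt n))
    (fun w => \prod_(v <- s) nexp
      (event_rate (fun p => 1 - nexp (horizon_cost c u p)) v w))
    (fun w => \prod_(v <- s) nexp (event_cost (offspring_cost c) u v w)).
Proof.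
move=> cc us sn.
pose HS := history_space (size_le n) (size_lt n).
have mid := @measurable_to_history (size_le n) (size_lt n).
pose phi v (z : HS * OmegaB) : \bar R := nexp (if born S v z.1 then
  offspring_rate c z.2 (location S v z.1) (u - birth S v z.1)%R else 0).
have uphi v : v \in s -> unit_fun (phi v).
  move=> vs; have Vv : size_le n v by rewrite /size_le/= (sn v vs).
  have mp := history_measurable_pos (U := size_lt n) Vv.
  have mp1 : measurable_fun setT (fun z : HS * OmegaB => birth S v z.1).
    exact: (measurableT_comp measurable_fst (measurableT_comp mp measurable_fst)).
  have mp2 : measurable_fun setT (fun z : HS * OmegaB => location S v z.1).
    exact: (measurableT_comp measurable_snd (measurableT_comp mp measurable_fst)).
  apply: unit_fun_nexp.
    apply: measurable_fun_ifT => //.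
      have mb := history_measurable_born (U := size_lt n) Vv.
      exact: (measurableT_comp mb measurable_fst).
    apply: measurable_offspring_rate => //.
    exact: measurable_funB.
  by move=> z; case: ifP => // _; exact: offspring_rate_ge0.
have := @cond_eq_freeze_prod R _ Omega P _ HS id mid _ OmegaB _ OmegaB PB _ s
  (mark S) (fun _ z => z.2) phi us
  (fun v _ => mark_measurable S_cluster v) (fun _ _ => measurable_snd) uphi.
move=> main; apply: eq_cond_eq (main _).
- move=> w; apply: eq_bigr => v _; rewrite /phi/= event_rate_horizon//.
- move=> w; apply: eq_bigr => v _; rewrite nexp_event_offspring_cost//.
move=> A mA G mG.
have mG' : @measurable _ Omega G by have := mid measurableT G mG; rewrite setTI.
rewrite preimage_id.
have mM v : v \in s -> measurable (mark S v @^-1` A v).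
  move=> _; rewrite -[X in measurable X]setTI.
  exact: (mark_measurable S_cluster).
transitivity (P (G `&` \bigcap_(v in [set` s]) (mark S v @^-1` A v))).
  exact: (setI_integral_prod P mG' mM).
transitivity (P G * \prod_(v <- s) PB (A v)).
  exact: (marks_independent S_cluster us sn mA mG).
transitivity (\int[P]_(w in G) cst (\prod_(v <- s) PB (A v)) w).
  by rewrite integral_cst// muleC.
apply: eq_integral => w _; apply: eq_bigr => v _.
by rewrite integral_indic// setIT.
Qed.

(** * Peeling off generations at a fixed horizon *)

Section horizon.
Context (u : R).
Hypothesis u_ge0 : (0 <= u)%R.

Definition alive_cost (v : seq nat) (w : Omega) : \bar R :=
  if [&& born S v w, birth S v w <= u & u < birth S v w + life S v w]%R then
    (f0 (location S v w))%:E
  else 0.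

Lemma alive_cost_ge0 v w : 0 <= alive_cost v w.
Proof. by rewrite /alive_cost; case: ifP => // _; rewrite lee_fin. Qed.

Lemma measurable_alive_cost v : measurable_fun setT (alive_cost v).
Proof.
have mb := measurable_birth v; have ml := life_measurable S_cluster v.
apply: measurable_fun_ifT => //.
  apply: measurable_and; first exact: (born_measurable S_cluster).
  apply: measurable_and; first exact: measurable_fun_ler.
  by apply: measurable_fun_ltr => //; exact: measurable_funD.
apply/measurable_EFinP; exact: (measurableT_comp mf0 (measurable_location v)).
Qed.

Lemma cluster_laplace_alive_cost :
  laplace P (alive S) (location S) f u =
  \int[P]_w nexp (\esum_(v in setT) alive_cost v w).
Proof.
apply: eq_integral => w _; congr (expeR (- _)).
rewrite esum_mkcond; apply: eq_esum => v _.
have f0E : f0 (location S v w) = f (location S v w).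
  by rewrite /patch mem_set//; exact: location_in_I.
rewrite /alive_cost f0E; congr (if _ then _ else _).
by apply/idP/idP => [/set_mem[-> -> ->]|/and3P[? ? ?]] //; apply/mem_set.
Qed.

(** An event is alive at [u] when its lifetime exceeds the time left; with births frozen, the mean
    over the lifetime is [life_laplace] at the location and time left. *)
Lemma lifetime_laplace (s : seq (seq nat)) : uniq s ->
  cond_eq P (id : Omega -> history_space setT setT)
    (fun w => \prod_(v <- s) nexp (alive_cost v w))
    (fun w => \prod_(v <- s) nexp (event_cost life_cost u v w)).
Proof.
move=> us.
pose HS := history_space setT setT.
have mid := @measurable_to_history setT setT.
have mp v := history_measurable_pos (V := setT) (U := setT) (v := v) Logic.I.
have mb v := history_measurable_born (V := setT) (U := setT) (v := v) Logic.I.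
have mp1 v : measurable_fun setT (birth S v : HS -> R).
  exact: (measurableT_comp measurable_fst (mp v)).
have mp2 v : measurable_fun setT (location S v : HS -> R).
  exact: (measurableT_comp measurable_snd (mp v)).
pose phi v (z : HS * R) : \bar R := nexp (if [&& born S v z.1,
   birth S v z.1 <= u & u < birth S v z.1 + z.2]%R then
    (f0 (location S v z.1))%:E else 0).
pose j v (z : HS * OmegaJ) := J0 (z.2, location S v z.1).
have mj v : measurable_fun setT (j v).
  have m1 : measurable_fun setT (fun z : HS * OmegaJ => (z.2, location S v z.1)).
    by apply: measurable_fun_pair => //; exact: (measurableT_comp (mp2 v) measurable_fst).
  exact: (measurableT_comp mJ0 m1).
have uphi v : unit_fun (phi v).
  have mb1 : measurable_fun setT (fun z : HS * R => birth S v z.1).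
    exact: (measurableT_comp (mp1 v) measurable_fst).
  have ml1 : measurable_fun setT (fun z : HS * R => location S v z.1).
    exact: (measurableT_comp (mp2 v) measurable_fst).
  apply: unit_fun_nexp; last by move=> z; case: ifP => // _; rewrite lee_fin.
  apply: measurable_fun_ifT => //.
    apply: measurable_and; first exact: (measurableT_comp (mb v) measurable_fst).
    apply: measurable_and; first exact: measurable_fun_ler.
    by apply: measurable_fun_ltr => //; exact: measurable_funD.
  by apply/measurable_EFinP; exact: (measurableT_comp mf0 ml1).
have := @cond_eq_freeze_prod R _ Omega P _ HS id mid _ R _ OmegaJ PJ _ s
  (life S) j phi us
  (fun v _ => life_measurable S_cluster v) (fun v _ => mj v) (fun v _ => uphi v).
move=> main; apply: eq_cond_eq (main _).
- by move=> w; apply: eq_bigr => v _.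
- move=> w; apply: eq_bigr => v _; rewrite /phi/= /event_cost.
  case: ifPn => bv /=; last first.
    by rewrite nexp0 (eq_integral (cst 1))// integral_cst//= mul1e probability_setT.
  rewrite /horizon_cost -/(birth S v w) -/(location S v w).
  case: ifPn => bu /=; last first.
    by rewrite nexp0 (eq_integral (cst 1))// integral_cst//= mul1e probability_setT.
  rewrite nexp_life_cost /life_laplace; apply: eq_integral => e _ /=.
  by rewrite ltrBlDl.
move=> A mA G mG.
have mG' : @measurable _ Omega G by have := mid measurableT G mG; rewrite setTI.
rewrite preimage_id.
have mM v : v \in s -> measurable (life S v @^-1` A v).
  move=> _; rewrite -[X in measurable X]setTI.
  exact: (life_measurable S_cluster).
transitivity (P (G `&` \bigcap_(v in [set` s]) (life S v @^-1` A v))).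
  exact: (setI_integral_prod P mG' mM).
transitivity (\int[P]_(w in G) \prod_(v <- s)
    PJ [set w' | A v (J w' (location S v w))]).
  exact: (lifetimes_independent S_cluster us mA mG).
apply: eq_integral => w _; apply: eq_bigr => v _.
have J0E e : J0 (e, location S v w) = J e (location S v w).
  by rewrite /patch mem_set//; split => //; exact: location_in_I.
have -> : [set w' | A v (J w' (location S v w))] =
    (fun e => j v (w, e)) @^-1` A v.
  by apply/seteqP; split => e /=; rewrite /j/= J0E.
rewrite -(setIT (_ @^-1` _)) -integral_indic//.
rewrite -[X in measurable X]setTI.
exact: (measurableT_comp (mj v) (pair1_measurable (w : HS))).
Qed.

(* Events of generation less than n are charged for their lifetimes only, those
   of generation n are charged the cost c. *)
Definition generation_laplace (n : nat) (c : R * R -> \bar R) : \bar R :=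
  \int[P]_w nexp (\esum_(v in size_lt n) event_cost life_cost u v w +
                  \esum_(v in size_eq n) event_cost c u v w).

Lemma event_cost_next c v w : cost_fun c ->
  event_cost (next_cost c) u v w =
  event_cost life_cost u v w + event_cost (offspring_cost c) u v w.
Proof.
by move=> cc; rewrite /event_cost /horizon_cost /next_cost; case: ifP;
  [case: ifP => _|]; rewrite ?adde0.
Qed.

Lemma generation_laplace0 c : cost_fun c -> generation_laplace 0 c = nexp (c (x, u)).
Proof.
move=> cc; rewrite /generation_laplace.
rewrite (_ : size_lt 0 = set0); last by apply/seteqP; split.
rewrite (_ : size_eq 0 = [set [::]]); last first.
  by apply/seteqP; split=> v; [move/size0nil|move=> ->].
rewrite (eq_integral (cst (nexp (c (x, u))))).
  by rewrite integral_cst//= probability_setT mule1.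
move=> w _; rewrite esum_set0 add0e esum_set1; last exact: event_cost_ge0.
have [b0 p0] := ancestor S_cluster w.
by rewrite /event_cost /horizon_cost b0 p0/= u_ge0 subr0.
Qed.

(** The lifetime costs of generations up to n, collected in [psi], are known to the history and act
    as a test function while the costs of generation n + 1 are averaged. *)
Lemma generation_laplaceS n c : cost_fun c ->
  generation_laplace n.+1 c = generation_laplace n (next_cost c).
Proof.
move=> cc; have coc := cost_fun_offspring_cost cc.
pose psi w := nexp (\esum_(v in size_le n) event_cost life_cost u v w).
have el0 v w : 0 <= event_cost life_cost u v w.
  by apply: event_cost_ge0; exact: cost_fun_life_cost.
have ec0 v w : 0 <= event_cost c u v w by exact: event_cost_ge0.
have eo0 v w : 0 <= event_cost (offspring_cost c) u v w.
  exact: event_cost_ge0.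
have ml v : measurable_fun setT (event_cost life_cost u v).
  by apply: measurable_event_cost; exact: cost_fun_life_cost.
have upsi : unit_fun psi by exact: unit_fun_nexp_esum.
(* [U] stays free because [psi] is used with two histories, with and without the marks of generation
   n. *)
have mpsi U : measurable_fun setT (psi : history_space (size_le n) U -> \bar R).
  (* [measurable_esum] asks for measurability at every label, but births of later generations are
     not in the history: they are masked by 0. *)
  rewrite (_ : psi = fun w => nexp (\esum_(v in setT)
      if v \in size_le n then event_cost life_cost u v w else 0)); last first.
    by apply/funext => w; rewrite /psi esum_mkcond.
  apply: measurable_nexp; apply: (@measurable_esum _ _ setT _ (history_space (size_le n) U)
    (fun v w => if v \in size_le n then event_cost life_cost u v w else 0)).
    move=> v; have [/set_mem vn|_] := boolP (v \in size_le n); last exact: measurable_cst.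
    exact: (history_measurable_event_cost u cost_fun_life_cost vn).
  by move=> v w; case: ifP.
have hg := cost_fun_horizon u cc.
have crate := cost_fun_sub1_nexp hg.
pose rate v w := event_rate (fun p => 1 - nexp (horizon_cost c u p)) v w.
pose kids v w := \sum_(i <oo) child_cost (horizon_cost c u) v w i.
have rate0 v w : 0 <= rate v w.
  by apply: event_rate_ge0 => p; case: crate => _; exact.
have mrate v : measurable_fun setT (rate v).
  exact: (measurable_event_rate v crate).
have kids0 v w : 0 <= kids v w.
  by apply: nneseries_ge0 => i _ _; apply: child_cost_ge0; case: hg.
have mkids v : measurable_fun setT (kids v).
  exact: (measurable_children_cost v hg).
have mo v : measurable_fun setT (event_cost (offspring_cost c) u v).
  exact: measurable_event_cost.
have uprod (a : seq nat -> Omega -> \bar R) (s : seq (seq nat)) :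
    (forall v, measurable_fun setT (a v)) -> (forall v w, 0 <= a v w) ->
    unit_fun (fun w => \prod_(v <- s) nexp (a v w)).
  by move=> ma a0; apply: unit_fun_prod => v _; exact: unit_fun_nexp.
transitivity (\int[P]_w (psi w * nexp (\esum_(v in size_eq n) kids v w))).
  apply: eq_integral => w _; rewrite size_ltS nexpD; last 2 first.
  - exact: esum_ge0.
  - exact: esum_ge0.
  by congr (_ * nexp _); rewrite esum_size_eqS.
(* Mean over the offspring, given the marks of generation n. *)
transitivity (\int[P]_w (psi w * nexp (\esum_(v in size_eq n) rate v w))).
  apply: eq_integral_nexp_esum => // s us sn.
  apply: (@cond_eq_integral _ _ Omega P _ (history_space (size_le n) (size_le n)) id
    _ _ _ psi) => //.
  - exact: measurable_to_history.
  - exact: uprod.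
  - exact: uprod.
  - exact: cond_eq_offspring.
  - by move=> w; exact: nexp_ge0.
(* Mean over those marks, now out of the history. *)
transitivity (\int[P]_w (psi w * nexp (\esum_(v in size_eq n)
    event_cost (offspring_cost c) u v w))).
  apply: eq_integral_nexp_esum => // s us sn.
  apply: (@cond_eq_integral _ _ Omega P _ (history_space (size_le n) (size_lt n)) id
    _ _ _ psi) => //.
  - exact: measurable_to_history.
  - exact: uprod.
  - exact: uprod.
  - exact: mark_laplace.
  - by move=> w; exact: nexp_ge0.
apply: eq_integral => w _; rewrite /psi -nexpD; last 2 first.
- exact: esum_ge0.
- exact: esum_ge0.
congr nexp; rewrite esum_size_le// -addeA; congr (_ + _).
by rewrite -esumD//; apply: eq_esum => v _; rewrite event_cost_next.
Qed.

(** The induction keeps [c] general, since each step changes the cost carried by the last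
    generation. *)
Lemma generation_laplace_iter n c : cost_fun c ->
  generation_laplace n c = nexp (iter n next_cost c (x, u)).
Proof.
elim: n c => [|n ih] c cc; first exact: generation_laplace0.
by rewrite generation_laplaceS// ih ?iterSr//; exact: cost_fun_next_cost.
Qed.

Lemma cluster_laplace_cvg :
  nexp (iter n next_cost life_cost (x, u)) @[n --> \oo] -->
  laplace P (alive S) (location S) f u.
Proof.
have el0 v w : 0 <= event_cost life_cost u v w.
  by apply: event_cost_ge0; exact: cost_fun_life_cost.
have ml v : measurable_fun setT (event_cost life_cost u v).
  by apply: measurable_event_cost; exact: cost_fun_life_cost.
have -> : laplace P (alive S) (location S) f u =
    \int[P]_w nexp (\esum_(v in setT) event_cost life_cost u v w).
  rewrite cluster_laplace_alive_cost.
  transitivity (\int[P]_w (1 * nexp (\esum_(v in setT) alive_cost v w))).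
    by apply: eq_integral => w _; rewrite mul1e.
  transitivity (\int[P]_w (1 * nexp (\esum_(v in setT) event_cost life_cost u v w))).
    apply: (@eq_integral_nexp_esum _ _ _ _ _ P (cst 1)) => //.
    - exact: unit_fun_cst1.
    - by move=> v; exact: measurable_alive_cost.
    - by move=> v w; exact: alive_cost_ge0.
    move=> s us _; have := lifetime_laplace us.
    (* Only the total mass of the conditional identity is used here: the test event is
       everything. *)
    move=> /(_ setT measurableT); rewrite preimage_setT.
    move=> e; transitivity (\int[P]_w \prod_(v <- s) nexp (alive_cost v w)).
      by apply: eq_integral => w _; rewrite mul1e.
    by rewrite e; apply: eq_integral => w _; rewrite mul1e.
  by apply: eq_integral => w _; rewrite mul1e.
(* With [life_cost] on the last generation, [generation_laplace n] charges all labels of length at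
   most n, that is less than n + 1. *)
have -> : (fun n => nexp (iter n next_cost life_cost (x, u))) =
    (fun n => \int[P]_w nexp (\esum_(v in size_lt n.+1) event_cost life_cost u v w)).
  apply/funext => n; rewrite -generation_laplace_iter; last exact: cost_fun_life_cost.
  by apply: eq_integral => w _; rewrite size_ltS esum_size_le.
rewrite (cvg_shiftS (fun n =>
  \int[P]_w nexp (\esum_(v in size_lt n) event_cost life_cost u v w))).
have ue V : unit_fun (fun w => nexp (\esum_(v in V) event_cost life_cost u v w)).
  exact: unit_fun_nexp_esum.
apply: (@dominated_cvg _ _ _ P setT measurableT _ _ (cst 1)) => //.
- by move=> n; case: (ue (size_lt n)).
- move=> w _; apply: nexp_cvg; last exact: esum_size_lt_cvg.
    by move=> n; exact: esum_ge0.
  exact: esum_ge0.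
- exact: finite_measure_integrable_cst.
- move=> n w _; rewrite gee0_abs ?(unit_fun_ge0 _ (ue (size_lt n)))//.
  exact: (unit_fun_le1 _ (ue (size_lt n))).
Qed.

End horizon.

End cluster_process.

End fixed_point.

End model.

Local Close Scope ereal_scope.

Theorem theorem8 (R : realType)
    (dB : measure_display) (OmegaB : measurableType dB)
    (PB : probability OmegaB R)
    (dJ : measure_display) (OmegaJ : measurableType dJ)
    (PJ : probability OmegaJ R)
    (lambda_oo h : R -> R) (W : R -> R -> R)
    (B : OmegaB -> R -> R -> R) (J : OmegaJ -> R -> R)
    (params : hawkes_parameters PB PJ lambda_oo h W B J)
    (d : measure_display) (Omega : measurableType d) (P : probability Omega R)
    (S : R -> event_tree OmegaB Omega)
    (S_cluster : forall x : R, unit_interval x ->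
       is_cluster PB PJ h W B J P (S x) x) :
  let eta := cluster_laplace P S in
  forall x : R, unit_interval x ->
  forall (f : R -> R) (u : R), bounded_measurable_nonneg f -> 0 <= u ->
    eta x f u = Phi PB PJ h W B J eta x f u.
Proof.
move=> eta x Ix f u bf u0.
(* Stated for all locations and times, since Phi at (x, u) involves eta at the locations of the
   children and at earlier times. The same sequence converges to both sides. *)
have etaE y t : unit_interval y -> 0 <= t ->
    eta y f t = nexp (limit_cost PB PJ h W B J f (y, t)).
  move=> Iy t0; have cvg_eta := cluster_laplace_cvg params bf (S_cluster y Iy) t0.
  have cvg_limit : (nexp (iterated_cost PB PJ h W B J f n (y, t)) @[n --> \oo] -->
      nexp (limit_cost PB PJ h W B J f (y, t)))%E.
    apply: nexp_cvg.
    - by move=> n; case: (cost_fun_iterated_cost params bf n).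
    - by case: (cost_fun_limit_cost params bf).
    - exact: (iterated_cost_cvg params bf).
  exact: (cvg_unique _ cvg_eta cvg_limit).
rewrite etaE// (nexp_limit_cost params bf) /Phi.
rewrite (beta_offspring_laplace params u (cost_fun_limit_cost params bf) Ix etaE).
by rewrite (gamma_life_laplace params).
Qed.
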